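(* Let $\Phi$ be an irreducible root system of rank $\ell$, let $n\geq0$ be an integer, and let $\mu:=\frac{n+1}{\gcd(n+1,\rho)}$. Then \[ \chi_{quasi}(\mathcal{A}_{\Phi}^{[1,n]},t)=\Big(\prod_{j=0}^{\ell}\frac{1}{\mu}[\mu]_{\mathrm{S}^{c_j\cdot\gcd(n+1,\rho)}}\Big)\,\chi_{quasi}(\mathcal{A}_{\Phi}^{[1,\gcd(n+1,\rho)-1]},t). \]
   Context: Root system data: $\Phi\subset V=\mathbb{R}^\ell$ is an irreducible crystallographic root system with positive system $\Phi^+$, simple roots $\alpha_1,\dots,\alpha_\ell$, highest root $\tilde\alpha=\sum_{i=1}^\ell c_i\alpha_i$, and $c_0:=1$; $Z(\Phi)=\{x\in V:(\alpha_i,x)\in\mathbb{Z}\ \forall i\}$. A quasi-polynomial is a function $\mathbb{Z}\to\mathbb{C}$ that agrees with a polynomial on each residue class modulo some positive integer (a period); the minimal period is the least such integer. $\rho$ is the minimal period of the Ehrhart quasi-polynomial $\mathrm{L}_\Phi$ of the closed fundamental alcove, i.e. $\mathrm{L}_\Phi(q)=\#\{x\in Z(\Phi):(\alpha_i,x)\ge0\ (1\le i\le\ell),\ (\tilde\alpha,x)\le q\}$ for $q\in\mathbb{Z}_{>0}$. $[c]_x:=\frac{1-x^c}{1-x}=1+x+\dots+x^{c-1}$; $\mathrm{S}$ is the shift operator $(\mathrm{S}g)(t)=g(t-1)$, and a polynomial in $\mathrm{S}$ acts by $\sum a_k\mathrm{S}^k g(t)=\sum a_k g(t-k)$. Linial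 arrangement: for $m\ge0$, $\mathcal{A}_\Phi^{[1,m]}=\{H_{\alpha,k}:\alpha\in\Phi^+,1\le k\le m\}$, $H_{\alpha,k}=\{x\in V:(\alpha,x)=k\}$ ($\mathcal{A}_\Phi^{[1,0]}=\emptyset$). Its characteristic quasi-polynomial $\chi_{quasi}(\mathcal{A}_\Phi^{[1,m]},t)$ is the quasi-polynomial equal, for all sufficiently large positive integers $q$, to $\#\{x\in Z(\Phi)/qZ(\Phi):(\alpha,x)\not\equiv k\bmod q\ \forall\alpha\in\Phi^+,1\le k\le m\}$. *)

(* Defs.v *)
From HB Require Import structures.
From mathcomp Require Import all_boot all_order all_algebra.
From mathcomp Require Import finmap boolp classical_sets functions cardinality.
From mathcomp Require Import reals complex.

Set Implicit Arguments.
Unset Strict Implicit.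
Unset Printing Implicit Defensive.

Import Order.TTheory GRing.Theory Num.Theory.
Local Open Scope classical_set_scope.
Local Open Scope ring_scope.

Section RootSystems.
Variables (R : realType) (l : nat).
Local Notation V := 'rV[R]_l.

Definition dot (u v : V) : R := \sum_(i < l) u 0 i * v 0 i.

Definition reflection (a v : V) : V := v - (2 * dot a v / dot a a) *: a.

Record root_system (Phi : {fset V}) : Prop := RootSystem {
  rs_span : <<enum_fset Phi>>%VS = fullv;
  rs_neq0 : forall a, a \in Phi -> a != 0;
  rs_reduced : forall (a : V) (r : R),
    a \in Phi -> r *: a \in Phi -> r = 1 \/ r = -1;
  rs_refl : forall a b, a \in Phi -> b \in Phi -> reflection a b \in Phi;
  rs_cryst : forall a b, a \in Phi -> b \in Phi ->
    2 * dot a b / dot a a \is a Num.int }.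

Definition irreducible_root_system (Phi : {fset V}) : Prop :=
  [/\ root_system Phi, Phi <> fset0 &
      forall A B : {fset V}, Phi = (A `|` B)%fset ->
        (forall a b, a \in A -> b \in B -> dot a b = 0) ->
        A = fset0 \/ B = fset0].

Definition nat_comb (alpha : 'I_l -> V) (v : V) : Prop :=
  exists k : 'I_l -> nat, v = \sum_(i < l) alpha i *+ k i.

Definition simple_roots (Phi : {fset V}) (alpha : 'I_l -> V) : Prop :=
  [/\ forall i, alpha i \in Phi,
      basis_of fullv (codom alpha) &
      forall b, b \in Phi -> nat_comb alpha b \/ nat_comb alpha (- b)].

(* Each choice of simple roots determines its positive system, and every
   positive system arises in this way. *)
Definition positive_roots (Phi : {fset V}) (alpha : 'I_l -> V) : set V :=
  [set b | b \in Phi /\ nat_comb alpha b].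

Definition highest_root (Phi : {fset V}) (alpha : 'I_l -> V) (theta : V) :
    Prop :=
  positive_roots Phi alpha theta /\
  forall b, positive_roots Phi alpha b -> nat_comb alpha (theta - b).

(* Z(Phi), written in terms of the simple roots *)
Definition coweight_lattice (alpha : 'I_l -> V) : set V :=
  [set x | forall i, dot (alpha i) x \is a Num.int].

End RootSystems.

Section QuasiPolynomials.
Variable C : comNzRingType.
Implicit Types f : int -> C.

Definition is_period f (p : nat) : Prop :=
  (0 < p)%N /\
  forall r : int, exists P : {poly C},
    forall t : int, (t = r %[mod p])%Z -> f t = P.[t%:~R].

Definition quasi_polynomial f : Prop := exists p, is_period f p.

Definition is_minimal_period f (p : nat) : Prop :=
  is_period f p /\ forall p', is_period f p' -> (p <= p')%N.

(* The action of a polynomial in the shift operator S, with 'X standing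
   for S. *)
Definition shift_act (P : {poly C}) f : int -> C :=
  fun t => \sum_(k < size P) P`_k * f (t - k%:Z).

End QuasiPolynomials.

(* [c]_x *)
Definition qint (A : pzSemiRingType) (c : nat) (x : A) : A :=
  \sum_(k < c) x ^+ k.

(* The number of elements of a finite set (0 if the set is infinite; all the
   sets counted below are finite). *)
Definition set_card (T : choiceType) (A : set T) : nat := #|` fset_set A|.

Section Counting.
Variables (R : realType) (l : nat).
Local Notation V := 'rV[R]_l.

Definition dilated_alcove (alpha : 'I_l -> V) (theta : V) (q : nat) : set V :=
  [set x | (forall i, 0 <= dot (alpha i) x) /\ dot theta x <= q%:R].

Definition is_ehrhart (alpha : 'I_l -> V) (theta : V) (f : int -> R[i]) :
    Prop :=
  quasi_polynomial f /\
  forall q : nat, (0 < q)%N ->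
    f q = (set_card (coweight_lattice alpha `&` dilated_alcove alpha theta q))%:R.

(* A quasi-polynomial is determined by its values at large positive integers,
   so at most one function satisfies is_ehrhart, and likewise is_char_quasi
   below; that such functions exist is Ehrhart's theorem, respectively a
   theorem of Kamiya, Takemura and Terao. *)
Definition ehrhart (alpha : 'I_l -> V) (theta : V) : int -> R[i] :=
  xget (fun=> 0) (is_ehrhart alpha theta).

(* An arrangement is given by pairs (a, k), standing for the hyperplanes
   H_{a,k} = {x | (a, x) = k}: reduction mod q needs the equations. *)
Definition linial (Phi : {fset V}) (alpha : 'I_l -> V) (m : nat) :
    set (V * nat) :=
  [set h | positive_roots Phi alpha h.1 /\ (1 <= h.2 <= m)%N].

Definition eqmodR (q : nat) (a b : R) : Prop :=
  exists z : int, a - b = z%:~R * q%:R.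

(* the class of x in Z(Phi) / q Z(Phi) *)
Definition lattice_coset (alpha : 'I_l -> V) (q : nat) (x : V) : set V :=
  [set x + z *+ q | z in coweight_lattice alpha].

(* The points of Z(Phi) / q Z(Phi) off all the hyperplanes mod q.  The
   condition does not depend on the representative x when the normals a are
   integral combinations of the alpha i. *)
Definition complement_mod (alpha : 'I_l -> V) (A : set (V * nat)) (q : nat) :
    set (set V) :=
  [set lattice_coset alpha q x | x in
    coweight_lattice alpha `&`
    [set x | forall a k, A (a, k) -> ~ eqmodR q (dot a x) k%:R]].

Definition is_char_quasi (alpha : 'I_l -> V) (A : set (V * nat))
    (f : int -> R[i]) : Prop :=
  quasi_polynomial f /\
  exists N : nat, forall q : nat, (N < q)%N ->
    f q = (set_card (complement_mod alpha A q))%:R.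

Definition char_quasi (alpha : 'I_l -> V) (A : set (V * nat)) : int -> R[i] :=
  xget (fun=> 0) (is_char_quasi alpha A).

End Counting.

(* c_0 = 1, followed by c_1, ..., c_l *)
Definition mark (l : nat) (c : 'I_l -> nat) (j : 'I_l.+1) : nat :=
  if unlift ord0 j is Some i then c i else 1%N.

(* Main.v *)
(* Let S be the shift, N(t) the number of y in N^(l+1) with sum_j c_j y_j = t,
   and L the Ehrhart quasi-polynomial of the fundamental alcove, so that L = N at
   positive integers.

   Geometry.  Every alcove is the image of the fundamental one under the affine
   Weyl group, so it has l+1 walls, i.e. affine roots w_0, ..., w_l with
   sum_j c_j w_j = 1, of which every affine root is, up to sign, a combination
   with coefficients in N.  Partition the box 0 < (alpha_i, x) <= q into the
   dilated alcoves containing their upper walls but not their lower walls.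
   A lattice point x of such a cell avoids the Linial hyperplanes mod q iff
   w_j(x) > n at every lower wall w_j, and x |-> (w_j(x))_j identifies these
   points with the solutions counted by N(q - (n+1) a), a being the sum of the
   marks of the lower walls.  Hence chi^[1,n] = P(S^(n+1)) L for
   P = sum_cells X^a, and for n = 0, where nothing is removed, P(S) N (q) = q^l.

   Algebra.  Put mu = (n+1)/g, D = prod_j (1 - X^(c_j)), so that D(S) N is the
   indicator of 0, and T = P(X^mu) - prod_j (1/mu) [mu]_{X^(c_j)} P.  As a
   coefficient sequence, T is prod_j (1 - S^(mu c_j)) applied to
   e(t) = mu^(-l) t^l ([mu | t] - 1/mu) on t > 0.  As [mu]_S^(l+1) annihilates
   this formula for e on all of Z, it maps e to a finitely supported sequence,
   which gives T = prod_j [c_j]_{X^mu} (1 - X) v for a polynomial v.  The period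
   rho is a multiple of all the c_j, so by considering roots of unity 1 - X^(c_j)
   divides [c_j]_{X^(n+1)} (1 - X^g); hence D divides T(X^g) and T(S^g) L = 0. *)
Require Import Defs.
From mathcomp Require Import all_boot all_order all_algebra.
From mathcomp Require Import finmap boolp classical_sets functions cardinality.
From mathcomp Require Import reals complex.
From mathcomp Require Import cyclic separable cyclotomic.
From mathcomp Require Import ring lra zify.
Import Order.TTheory GRing.Theory Num.Theory.
Local Open Scope ring_scope.

Set Implicit Arguments.
Unset Strict Implicit.
Unset Printing Implicit Defensive.

(** * The action of polynomials in the shift *)

Section ShiftAction.
Variable C : comNzRingType.
Implicit Types (P Q : {poly C}) (f g : int -> C).

Lemma shift_act_wide B P f t : (size P <= B)%N ->
  shift_act P f t = \sum_(k < B) P`_k * f (t - k%:Z).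
Proof.
move=> leB; rewrite /shift_act (big_ord_widen B (fun k => P`_k * f (t - k%:Z))) //.
rewrite [RHS](bigID (fun k : 'I_B => (k < size P)%N)) /= [X in _ + X]big1 ?addr0 //.
by move=> i; rewrite -leqNgt => /(nth_default 0) ->; rewrite mul0r.
Qed.

Lemma eq_shift_act P f g : f =1 g -> shift_act P f =1 shift_act P g.
Proof. by move=> efg t; apply: eq_bigr => k _; rewrite efg. Qed.

Lemma shift_actD P Q f t : shift_act (P + Q) f t = shift_act P f t + shift_act Q f t.
Proof.
pose B := maxn (size P) (size Q).
rewrite (@shift_act_wide B (P + Q)) ?size_polyD // (@shift_act_wide B P) ?leq_maxl //.
rewrite (@shift_act_wide B Q) ?leq_maxr // -big_split.
by apply: eq_bigr => k _; rewrite coefD mulrDl.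
Qed.

Lemma shift_actZ a P f t : shift_act (a *: P) f t = a * shift_act P f t.
Proof.
rewrite !(@shift_act_wide (size P)) ?size_scale_leq // mulr_sumr.
by apply: eq_bigr => k _; rewrite coefZ mulrA.
Qed.

Lemma shift_act0 f t : shift_act 0 f t = 0.
Proof. by rewrite /shift_act size_poly0 big_ord0. Qed.

Lemma shift_actN P f t : shift_act (- P) f t = - shift_act P f t.
Proof. by rewrite -scaleN1r shift_actZ mulN1r. Qed.

Lemma shift_actB P Q f t : shift_act (P - Q) f t = shift_act P f t - shift_act Q f t.
Proof. by rewrite shift_actD shift_actN. Qed.

Lemma shift_act_sum (I : Type) (r : seq I) (p : pred I) (F : I -> {poly C}) f t :
  shift_act (\sum_(i <- r | p i) F i) f t = \sum_(i <- r | p i) shift_act (F i) f t.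
Proof.
elim/big_rec2: _ => [|i x P _ <-]; first exact: shift_act0.
by rewrite shift_actD.
Qed.

Lemma shift_actC a f t : shift_act a%:P f t = a * f t.
Proof.
by rewrite (@shift_act_wide 1) ?size_polyC ?leq_b1 // big_ord1 coefC subr0.
Qed.

Lemma shift_act1 f t : shift_act 1 f t = f t.
Proof. by rewrite -[1]/(1%:P) shift_actC mul1r. Qed.

Lemma shift_actMX P f t : shift_act (P * 'X) f t = shift_act P f (t - 1).
Proof.
rewrite (@shift_act_wide (size P).+1); last first.
  by have [->|P0] := eqVneq P 0; rewrite ?mul0r ?size_poly0 ?size_mulX.
rewrite big_ord_recl coefMX mul0r add0r; apply: eq_bigr => k _.
by rewrite coefMX /= /bump /= add1n; congr (_ * f _); lia.
Qed.

Lemma shift_actM P Q f : shift_act (P * Q) f =1 shift_act P (shift_act Q f).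
Proof.
elim/poly_ind: P => [|P a IHP] t; first by rewrite mul0r !shift_act0.
rewrite mulrDl !shift_actD mul_polyC shift_actC shift_actZ; congr (_ + _).
by rewrite mulrAC !shift_actMX IHP.
Qed.

Lemma shift_actXn m f t : shift_act 'X^m f t = f (t - m%:Z).
Proof.
elim: m t => [|m IHm] t; first by rewrite expr0 shift_act1 subr0.
by rewrite exprSr shift_actMX IHm; congr f; lia.
Qed.

Lemma shift_act_1subXn m f t : shift_act (1 - 'X^m) f t = f t - f (t - m%:Z).
Proof. by rewrite shift_actB shift_act1 shift_actXn. Qed.

Lemma shift_act_fun0 P f : f =1 (fun=> 0) -> shift_act P f =1 (fun=> 0).
Proof. by move=> f0 t; rewrite /shift_act big1 // => k _; rewrite f0 mulr0. Qed.

Lemma shift_act_funB P f g t :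
  shift_act P (fun s => f s - g s) t = shift_act P f t - shift_act P g t.
Proof. by rewrite /shift_act -sumrB; apply: eq_bigr => k _; rewrite mulrBr. Qed.

Lemma shift_act_funZ P a f t :
  shift_act P (fun s => a * f s) t = a * shift_act P f t.
Proof. by rewrite /shift_act mulr_sumr; apply: eq_bigr => k _; rewrite mulrCA. Qed.

Lemma dvd_shift_act0 P Q f :
  shift_act P f =1 (fun=> 0) -> shift_act (Q * P) f =1 (fun=> 0).
Proof. by move=> Pf t; rewrite shift_actM shift_act_fun0. Qed.

Lemma shift_act_compXn P m f t :
  shift_act (P \Po 'X^m) f t = \sum_(k < size P) P`_k * f (t - (m * k)%:Z).
Proof.
rewrite comp_polyE shift_act_sum; apply: eq_bigr => k _.
by rewrite shift_actZ -exprM shift_actXn.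
Qed.

(** Since S^k (t f) = (t - k) S^k f, moving t past P(S) costs the Euler derivative X P'(X). *)
Lemma shift_act_mulid P f t :
  shift_act P (fun s => s%:~R * f s) t
    = t%:~R * shift_act P f t - shift_act (P^`() * 'X) f t.
Proof.
rewrite [X in _ - X](@shift_act_wide (size P)); last first.
  have [->|P0] := eqVneq P 0; first by rewrite deriv0 mul0r size_poly0.
  have [->|dP0] := eqVneq P^`() 0; first by rewrite mul0r size_poly0.
  by rewrite size_mulX // lt_size_deriv.
rewrite /shift_act mulr_sumr -sumrB; apply: eq_bigr => -[k lek] _ /=.
rewrite coefMX intrB mulrBl mulrBr mulrCA; congr (_ - _).
case: k lek => [|k] lek /=; first by rewrite !mul0r mulr0.
by rewrite coef_deriv mulrA -mulr_natr.
Qed.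

(** The derivative of P^(k+1) is a multiple of P^k, so the commutator with t is killed as well. *)
Lemma shift_act_exp_mulid P k f :
  shift_act (P ^+ k) f =1 (fun=> 0) ->
  shift_act (P ^+ k.+1) (fun s => s%:~R * f s) =1 (fun=> 0).
Proof.
move=> Pf t; rewrite shift_act_mulid exprS dvd_shift_act0 // mulr0 sub0r.
rewrite -exprS deriv_exp -pred_Sn -[P^`() * _ *+ _]mulr_natr.
have -> : P^`() * P ^+ k * k.+1%:R * 'X = P^`() * k.+1%:R * 'X * P ^+ k by ring.
by rewrite dvd_shift_act0 ?oppr0.
Qed.

Lemma shift_act_expn_mulid P k f :
  shift_act P f =1 (fun=> 0) ->
  shift_act (P ^+ k.+1) (fun s => s%:~R ^+ k * f s) =1 (fun=> 0).
Proof.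
move=> Pf; elim: k => [|k IHk] t.
  by rewrite expr1 (eq_shift_act _ (_ : _ =1 f)) // => s; rewrite mul1r.
rewrite -(shift_act_exp_mulid IHk t); apply: eq_shift_act => s.
by rewrite exprS mulrA.
Qed.

(** P(S) turns this indicator into the coefficient sequence of P, so that equalities of polynomials
    can be proved as equalities of functions on Z. *)
Definition delta0 (t : int) : C := (t == 0)%:R.

Lemma shift_act_delta0 P (k : nat) : shift_act P delta0 k = P`_k.
Proof.
rewrite (@shift_act_wide (maxn (size P) k.+1)) ?leq_maxl //.
have lek : (k < maxn (size P) k.+1)%N by rewrite leq_max leqnn orbT.
rewrite (bigD1 (Ordinal lek)) //= big1 ?addr0; first by rewrite /delta0 subrr eqxx mulr1.
move=> i /negP ne; rewrite /delta0; case: eqP => [e|]; last by rewrite mulr0.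
by case: ne; apply/eqP/val_inj => /=; lia.
Qed.

Lemma shift_act_delta0_inj P Q :
  shift_act P delta0 =1 shift_act Q delta0 -> P = Q.
Proof. by move=> e; apply/polyP => k; rewrite -!shift_act_delta0 e. Qed.

Lemma finite_support_poly f B :
  (forall t : int, t < 0 -> f t = 0) -> (forall t : int, B%:Z <= t -> f t = 0) ->
  f =1 shift_act (\poly_(k < B) f k) delta0.
Proof.
move=> f0 fB [k|k]; last first.
  rewrite f0 // /shift_act big1 // => i _; rewrite /delta0.
  by case: eqP => [|_]; [lia | rewrite mulr0].
rewrite shift_act_delta0 coef_poly; case: ltnP => // leB.
by rewrite fB.
Qed.

End ShiftAction.

(** * Quasi-polynomials *)

Section QuasiPolynomials.
Variable C : numFieldType.
Implicit Types (P Q : {poly C}) (f : int -> C).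

Lemma quasi_polyP f p : is_period f p ->
  exists2 Q : int -> {poly C}, (0 < p)%N
    & forall r t, (t = r %[mod p])%Z -> f t = (Q r).[t%:~R].
Proof. by case=> p_gt0 /choice[Q fQ]; exists Q. Qed.

Lemma is_period_dvd f p q : is_period f p -> (0 < q)%N -> (p %| q)%N -> is_period f q.
Proof.
move=> [p_gt0 fp] q_gt0 /dvdnP[m eq_q]; split=> // r; have [Q fQ] := fp r.
exists Q => t etr; apply: fQ; apply/eqP; rewrite eqz_mod_dvd.
apply: (@dvdz_trans q%:Z); first by rewrite eq_q PoszM dvdz_mull.
by rewrite -eqz_mod_dvd; apply/eqP.
Qed.

Lemma is_period_sub f g p : is_period f p -> is_period g p ->
  is_period (fun t => f t - g t) p.
Proof.
move=> [p_gt0 fp] [_ gp]; split=> // r.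
have [[P fP] [Q gQ]] := (fp r, gp r); exists (P - Q) => t e.
by rewrite hornerD hornerN fP ?gQ.
Qed.

Lemma quasi_polynomial_sub f g : quasi_polynomial f -> quasi_polynomial g ->
  quasi_polynomial (fun t => f t - g t).
Proof.
move=> [p fp] [q gq]; exists (p * q)%N.
have p_gt0 := fp.1; have q_gt0 := gq.1.
have pq_gt0 : (0 < p * q)%N by rewrite muln_gt0 p_gt0.
apply: is_period_sub.
  exact: is_period_dvd fp pq_gt0 (dvdn_mulr _ (dvdnn p)).
exact: is_period_dvd gq pq_gt0 (dvdn_mull _ (dvdnn q)).
Qed.

Lemma is_period_shift_act P f p : is_period f p -> is_period (shift_act P f) p.
Proof.
move=> /quasi_polyP[Q p_gt0 fQ]; split=> // r.
exists (\sum_(k < size P) P`_k *: (Q (r - k%:Z) \Po ('X - (k%:R)%:P))) => t e.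
rewrite horner_sum; apply: eq_bigr => k _.
rewrite hornerZ horner_comp !hornerE; congr (_ * _).
rewrite (fQ (r - k%:Z)) ?intrB // .
by apply/eqP; rewrite eqz_mod_dvd opprD opprK addrACA addNr addr0 -eqz_mod_dvd; apply/eqP.
Qed.

Lemma quasi_polynomial_shift_act P f :
  quasi_polynomial f -> quasi_polynomial (shift_act P f).
Proof. by case=> p /(is_period_shift_act P) ?; exists p. Qed.

Lemma poly_eq0_infinite P (x : nat -> C) :
  injective x -> (forall k, P.[x k] = 0) -> P = 0.
Proof.
move=> x_inj Px; apply/eqP; apply: contraT => P0.
have := @max_poly_roots C P [seq x k | k <- iota 0 (size P)] P0.
rewrite map_inj_uniq // iota_uniq size_map size_iota ltnn; apply=> //.
by apply/allP => _ /mapP[k _ ->]; rewrite rootE Px.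
Qed.

(** Every residue class modulo a period contains infinitely many q > N, and a polynomial with
    infinitely many zeros is 0. *)
Lemma quasi_polynomial_eq0 f (N : nat) : quasi_polynomial f ->
  (forall q : nat, (N < q)%N -> f q = 0) -> f =1 (fun=> 0).
Proof.
move=> [p [p_gt0 fp]] f0 t; have [Q fQ] := fp t.
rewrite (fQ t erefl); pose m := (N.+1 + `|t|)%N.
have mE k : (t + ((m + k) * p)%:Z)%R = `|(t + ((m + k) * p)%:Z)%R|%N :> int.
  by rewrite gez0_abs // /m; nia.
suff -> : Q = 0 by rewrite horner0.
apply: (@poly_eq0_infinite _ (fun k => (t + ((m + k) * p)%:Z)%:~R)) => [k1 k2|k].
  by move/intr_inj; nia.
rewrite -fQ; last by rewrite PoszM addrC modzMDl.
by rewrite mE f0 // /m; nia.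
Qed.

Lemma quasi_polynomial_eq f g (N : nat) : quasi_polynomial f -> quasi_polynomial g ->
  (forall q : nat, (N < q)%N -> f q = g q) -> f =1 g.
Proof.
move=> fqp gqp fg t; apply/eqP; rewrite -subr_eq0; apply/eqP.
have := @quasi_polynomial_eq0 (fun s => f s - g s) N (quasi_polynomial_sub fqp gqp).
by apply=> q /fg ->; rewrite subrr.
Qed.

(** [Q] and its translate share degree and leading coefficient, which cancels. *)
Lemma size_sub_comp_XsubC Q (a : C) k : (size Q <= k.+1)%N ->
  (size (Q - (Q \Po ('X - a%:P)))%R <= k)%N.
Proof.
have s2 : size ('X - a%:P) = 2 by rewrite size_XsubC.
have [->|Q0] := eqVneq Q 0; first by rewrite comp_poly0 subrr size_poly0.
move=> leQ; apply/leq_sizeP => j lekj; rewrite coefB.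
have sE : size (Q \Po ('X - a%:P)) = size Q by rewrite size_comp_poly2.
have [ltj|] := leqP (size Q) j; first by rewrite !nth_default ?sE // subrr.
move=> ltj; have -> : j = (size Q).-1 by lia.
rewrite -[X in _ - _`_X.-1]sE -!lead_coefE lead_coef_comp ?s2 //.
by rewrite lead_coefXsubC expr1n mulr1 subrr.
Qed.

(** On each residue class 1 - S^p is a difference operator of step p and lowers the degree; k bounds
    the sizes of the p constituents. *)
Lemma period_annihilated f p : is_period f p ->
  exists k, shift_act ((1 - 'X^p) ^+ k) f =1 (fun=> 0).
Proof.
move=> /quasi_polyP[Q p_gt0 fQ].
pose k := \max_(i < p) size (Q i); exists k.
have {fQ} : forall r : int, exists2 P : {poly C}, (size P <= k)%N &
    forall t : int, (t = r %[mod p])%Z -> f t = P.[t%:~R].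
  move=> r; have rp0 : (0 <= r %% p)%Z by rewrite modz_ge0 //; lia.
  have ltrp : (`|(r %% p)%Z| < p)%N by rewrite -ltz_nat gez0_abs // ltz_pmod.
  exists (Q (Ordinal ltrp)); first exact: leq_bigmax.
  by move=> t e; apply: fQ => /=; rewrite gez0_abs // modz_mod.
move: k => k; elim: k f => [|k IHk] f fQ t.
  have [P] := fQ t; rewrite leqn0 size_poly_eq0 => /eqP -> /(_ t erefl).
  by rewrite expr0 shift_act1 horner0.
rewrite exprSr shift_actM; move: t; apply: IHk => r.
have [P leP fP] := fQ r.
exists (P - (P \Po ('X - (p%:R)%:P))); first exact: size_sub_comp_XsubC.
move=> t e; rewrite shift_act_1subXn hornerD hornerN horner_comp !hornerE fP //.
rewrite fP ?intrB //; apply/eqP; rewrite eqz_mod_dvd.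
by rewrite addrAC rpredB ?dvdzz // -eqz_mod_dvd; apply/eqP.
Qed.

(** The rising factorials r_d = X (X + a) ... (X + (d-1) a) satisfy r_(d+1)(X) - r_(d+1)(X - a) =
    (d+1) a r_d, so leading terms can be removed one at a time. *)
Lemma poly_antidifference (a : C) Q : a != 0 ->
  exists G, G - (G \Po ('X - a%:P)) = Q.
Proof.
move=> a0; pose r d : {poly C} := \prod_(i < d) ('X - (- (i%:R * a))%:P).
have r_monic d : r d \is monic by exact: monic_prod_XsubC.
have size_r d : size (r d) = d.+1.
  by rewrite /r size_prod_XsubC [index_enum _]unlock -enumT size_enum_ord.
have diff_r d : r d.+1 - (r d.+1 \Po ('X - a%:P)) = (d.+1%:R * a) *: r d.
  have -> : r d.+1 \Po ('X - a%:P) = ('X - a%:P) * r d.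
    rewrite /r rmorph_prod big_ord_recl /= -/(comp_poly _ _) comp_polyB comp_polyX comp_polyC.
    rewrite mul0r oppr0 subr0; congr (_ * _); apply: eq_bigr => i _.
    rewrite -/(comp_poly _ _) comp_polyB comp_polyX comp_polyC -addrA -opprD -polyCD.
    by congr (_ - _%:P); rewrite /bump /= add1n -natr1; ring.
  rewrite /r big_ord_recr /= -/(r d) -mul_polyC mulrC -mulrBl; congr (_ * _).
  by rewrite -addrA addrCA opprD opprK addNKr -polyCN opprK -polyCD -natr1 mulrDl mul1r addrC.
have [n] := ubnP (size Q); elim: n Q => // n IHn Q; rewrite ltnS => leQ.
have [->|Q0] := eqVneq Q 0; first by exists 0; rewrite comp_poly0 subrr.
pose d := (size Q).-1; pose b := lead_coef Q / (d.+1%:R * a).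
have da0 : d.+1%:R * a != 0 by rewrite mulf_neq0 ?pnatr_eq0.
have sQ : size Q = d.+1 by rewrite /d prednK ?size_poly_gt0.
have [|G eG] := IHn (Q - lead_coef Q *: r d).
  apply: leq_trans leQ; rewrite sQ ltnS; apply/leq_sizeP => j lej.
  rewrite coefB coefZ; have [->|nej] := eqVneq j d.
    have := monicP (r_monic d); rewrite !lead_coefE size_r sQ /= => ->.
    by rewrite mulr1 subrr.
  by rewrite !nth_default ?sQ ?size_r ?mulr0 ?subrr //; lia.
exists (G + b *: r d.+1).
rewrite comp_polyD comp_polyZ opprD addrACA eG -scalerBr diff_r scalerA.
by rewrite mulfVK // subrK.
Qed.

(** A step p = c p0 preserves residue classes, so there the polynomial antidifferences of the
    constituents suffice; 1 - X^p = (1 - X^c) sum_(i < p0) X^(c i) then passes from step p to step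
    c. *)
Lemma quasi_poly_antidifference f (c : nat) : (0 < c)%N -> quasi_polynomial f ->
  exists2 F, quasi_polynomial F & forall t, F t - F (t - c%:Z) = f t.
Proof.
move=> c_gt0 [p0 fp0]; pose p := (c * p0)%N; have p0_gt0 := fp0.1.
have p_gt0 : (0 < p)%N by rewrite muln_gt0 c_gt0.
have /quasi_polyP[Q _ fQ] : is_period f p by apply: is_period_dvd fp0 _ (dvdn_mull _ _).
have pC0 : p%:R != 0 :> C by rewrite pnatr_eq0 -lt0n.
have /choice[G QG] : forall r : int, exists G, G - (G \Po ('X - (p%:R)%:P)) = Q r.
  by move=> r; apply: poly_antidifference.
pose F t : C := (G (t %% p)%Z).[t%:~R].
have Fqp : quasi_polynomial F.
  by exists p; split=> // r; exists (G (r %% p)%Z) => t; rewrite /F => ->.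
have FE t : F t - F (t - p%:Z) = f t.
  rewrite (fQ (t %% p)%Z) ?modz_mod // -QG hornerD hornerN horner_comp !hornerE.
  rewrite /F intrB; suff -> : ((t - p%:Z) %% p)%Z = (t %% p)%Z by [].
  by apply/eqP; rewrite eqz_mod_dvd addrAC subrr sub0r rpredN dvdzz.
exists (shift_act (\sum_(i < p0) 'X^(c * i)) F).
  exact: quasi_polynomial_shift_act.
move=> t; rewrite -shift_act_1subXn -shift_actM -FE -shift_act_1subXn.
congr (shift_act _ _ _); rewrite /p exprM -[1 - ('X^c) ^+ p0]opprB subrX1 -mulNr opprB.
by congr (_ * _); apply: eq_bigr => i _; rewrite exprM.
Qed.

Definition unit_root_prod (cs : seq nat) : {poly C} := \prod_(c <- cs) (1 - 'X^c).

(** Induction on the factors: from some point on, (1 - S^c) f is a quasi-polynomial, and [f] differs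
    from an antidifference [G] of it by a c-periodic function. *)
Lemma recurrence_quasi_polynomial (cs : seq nat) f (m0 : int) :
  all (leq 1) cs ->
  (forall t, m0 <= t -> shift_act (unit_root_prod cs) f t = 0) ->
  exists2 F, quasi_polynomial F
    & forall t, m0 <= t + (sumn cs)%:Z -> F t = f t.
Proof.
rewrite /unit_root_prod; elim: cs f => [|c cs IHcs] f /=.
  move=> _ f0; exists (fun=> 0); last first.
    by move=> t; rewrite addr0 => /f0; rewrite big_nil shift_act1.
  by exists 1%N; split=> // r; exists 0 => t _; rewrite horner0.
case/andP=> c_gt0 cs_gt0 f0.
have [|F' F'qp F'E] := IHcs (shift_act (1 - 'X^c) f) cs_gt0.
  by move=> t /f0; rewrite big_cons mulrC shift_actM.
have [G Gqp GE] := quasi_poly_antidifference c_gt0 F'qp.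
pose a := m0 - (sumn cs)%:Z - c%:Z; pose d t := f t - G t.
have dper t : a + c%:Z <= t -> d t = d (t - c%:Z).
  move=> let_; have := GE t; rewrite F'E; last by move: let_; rewrite /a; lia.
  rewrite shift_act_1subXn /d => e.
  have -> : G t = G (t - c%:Z) + (f t - f (t - c%:Z)) by rewrite -e addrC subrK.
  by ring.
(* The c-periodic extension to Z of [d] restricted to the window a <= t < a + c. *)
pose e t := d (a + ((t - a) %% c)%Z).
exists (fun t => G t - (- e t)).
  apply: quasi_polynomial_sub => //; exists c; split=> // r.
  exists ((- e r)%:P) => t tr; rewrite hornerC /e; congr (- d (a + _)).
  apply/eqP; rewrite eqz_mod_dvd (_ : t - a - (r - a) = t - r); last by lia.
  by rewrite -eqz_mod_dvd; apply/eqP.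
move=> t let_; rewrite opprK.
suff -> : e t = d t by rewrite /d addrCA subrr addr0.
have [k ek] : exists k : nat, t - a = ((t - a) %% c)%Z + (k * c)%:Z.
  exists `|((t - a) %/ c)%Z|%N; rewrite PoszM gez0_abs.
    by rewrite [RHS]addrC -divz_eq.
  by rewrite divz_ge0 ?ltz_nat // /a; lia.
have m_ge0 : (0 <= (t - a) %% c)%Z by rewrite modz_ge0 //; lia.
rewrite /e; have {ek} : t = a + ((t - a) %% c)%Z + (k * c)%:Z by lia.
move: ((t - a) %% c)%Z m_ge0 => m m_ge0 -> {let_}.
elim: k => [|k IHk]; first by rewrite mul0n addr0.
rewrite [RHS]dper; last by lia.
by rewrite IHk; congr d; lia.
Qed.

End QuasiPolynomials.

(** * Solutions of the linear equation given by the marks *)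

Lemma set_card_param (T : choiceType) (I : finType) (P : pred I) (f : I -> T)
    (A : set T) :
  {in P &, injective f} -> (forall i, P i -> A (f i)) ->
  (forall x, A x -> exists2 i, P i & f i = x) -> set_card A = #|P|.
Proof.
move=> f_inj PA AP; rewrite /set_card.
have -> : A = [set` [fset x in [seq f i | i <- enum P]]%fset]%classic.
  have memE x : (x \in [fset x in [seq f i | i <- enum P]]%fset)
      = (x \in [seq f i | i <- enum P]) by rewrite in_fset.
  apply/seteqP; split=> x /=; rewrite memE.
    by move=> /AP[i Pi <-]; rewrite map_f // mem_enum.
  by case/mapP=> i; rewrite mem_enum => Pi ->; apply: PA.
rewrite set_fsetK card_fseq undup_id ?size_map -?cardE //.
rewrite map_inj_in_uniq ?enum_uniq // => i j; rewrite !mem_enum; exact: f_inj.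
Qed.

Section SolutionCount.
Variables (C : numFieldType) (J : finType) (m : J -> nat).
Hypothesis m_gt0 : forall j, (0 < m j)%N.

Definition solutions (k : nat) : set {ffun J -> nat} :=
  [set y | (\sum_j m j * y j = k)%N].

(** With the value 0 at negative t this is, on all of Z, the coefficient sequence of the power
    series prod_j 1 / (1 - X^(m_j)). *)
Definition nsol (t : int) : C :=
  if t is Posz k then (set_card (solutions k))%:R else 0.

Definition mark_prod : {poly C} := \prod_j (1 - 'X^(m j)).

Lemma solutions_le k y j : solutions k y -> (y j <= k)%N.
Proof.
move=> <-; rewrite (bigD1 j) //=; apply: leq_trans (leq_addr _ _).
by rewrite leq_pmull.
Qed.

Lemma card_solutions B k : (k < B)%N ->
  set_card (solutions k) = #|[pred y : {ffun J -> 'I_B} | \sum_j m j * y j == k]%N|.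
Proof.
move=> ltk; apply: (@set_card_param {ffun J -> nat} {ffun J -> 'I_B} [pred y | _]
  (fun y => [ffun j => y j : nat]) (solutions k)).
- move=> y z _ _ /ffunP e; apply/ffunP => j; apply/val_inj.
  by have := e j; rewrite !ffunE.
- by move=> y /eqP <-; apply: eq_bigr => j _; rewrite ffunE.
move=> y yk; have lty j : (y j < B)%N := leq_ltn_trans (solutions_le j yk) ltk.
exists [ffun j => Ordinal (lty j)]; last by apply/ffunP => j; rewrite !ffunE.
by apply/eqP; rewrite -[RHS]yk; apply: eq_bigr => j _; rewrite ffunE.
Qed.

(** All entries of a solution for k < B lie below B, so truncated geometric series suffice. *)
Lemma nsol_coef B k : (k < B)%N ->
  nsol k = (\prod_j qint B ('X^(m j) : {poly C}))`_k.
Proof.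
move=> ltk; rewrite /nsol (card_solutions ltk) /qint bigA_distr_bigA coef_sum /=.
rewrite -sum1_card natr_sum big_mkcond; apply: eq_bigr => y _ /=.
have -> : \prod_j ('X^(m j)) ^+ y j = 'X^(\sum_j m j * y j)%N :> {poly C}.
  by rewrite expr_sum; apply: eq_bigr => j _; rewrite exprM.
by rewrite coefXn [in RHS]eq_sym inE; case: eqP.
Qed.

(** This is D times 1/D = 1, read off modulo X^(k+1) so that only polynomials occur. *)
Lemma mark_prod_nsol : shift_act mark_prod nsol =1 delta0 C.
Proof.
case=> k; last first.
  by rewrite /shift_act big1 // => i _; rewrite (_ : _ - _ = Negz (k + i)) ?mulr0 //; lia.
rewrite (@shift_act_wide _ (maxn (size mark_prod) k.+1)) ?leq_maxl //.
rewrite -(big_mkord xpredT (fun i => mark_prod`_i * nsol (k%:Z - i%:Z))).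
rewrite (big_cat_nat _ (n := k.+1)) ?leq_maxr //= [X in _ + X]big1_seq ?addr0; last first.
  move=> i; rewrite mem_index_iota => /andP[_ /andP[lti _]].
  by rewrite (_ : _ - _ = Negz (i - k.+1)) ?mulr0 //; lia.
pose G : {poly C} := \prod_j qint k.+1 ('X^(m j)).
transitivity ((mark_prod * G)`_k).
  rewrite coefM big_mkord; apply: eq_bigr => -[i lti] _ /=.
  by rewrite subzn // (@nsol_coef k.+1) // ltnS leq_subr.
(* Each factor telescopes to 1 - X^(m_j (k+1)), which is 1 modulo X^(k+1). *)
suff [w ->] : exists w, mark_prod * G = 1 + 'X^(k.+1) * w.
  by rewrite coefD coefXnM ltnSn addr0 coef1 /delta0; case: k {G}.
rewrite -big_split /=; elim/big_ind: _.
- by exists 0; rewrite mulr0 addr0.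
- by move=> _ _ [u ->] [v ->]; exists (u + v + u * 'X^(k.+1) * v); ring.
move=> j _; exists (- 'X^((m j).-1 * k.+1)).
have -> : (1 - 'X^(m j)) * qint k.+1 'X^(m j) = 1 - 'X^(m j) ^+ k.+1 :> {poly C}.
  by rewrite -[in RHS]opprB subrX1 -mulNr opprB.
rewrite mulrN -exprD -exprM; congr (1 - 'X^_); have := m_gt0 j; nia.
Qed.

Lemma nsol_quasi_polynomial :
  exists2 L, quasi_polynomial L & forall t : int, 1 <= t -> L t = nsol t.
Proof.
have eqD : mark_prod = unit_root_prod C [seq m j | j <- enum J].
  by rewrite /unit_root_prod big_map big_enum.
have [|t t_gt0|L Lqp LE] := @recurrence_quasi_polynomial C [seq m j | j <- enum J] nsol 1.
- by apply/allP => _ /mapP[j _ ->].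
- by rewrite -eqD mark_prod_nsol /delta0; case: eqP => // t0; lia.
by exists L => // t t_gt0; apply: LE; lia.
Qed.

Lemma shift_act_far (P : {poly C}) f g :
  (forall t : int, 1 <= t -> f t = g t) ->
  forall t : int, (size P)%:Z <= t -> shift_act P f t = shift_act P g t.
Proof.
move=> fg t let_; apply: eq_bigr => -[k ltk] _ /=; rewrite fg //.
by move: (size P) ltk let_ => N; lia.
Qed.

(** D(S) L agrees with [delta0] at large arguments, hence vanishes there, and it is a
    quasi-polynomial. *)
Lemma mark_prod_quasi L : quasi_polynomial L ->
  (forall t : int, 1 <= t -> L t = nsol t) -> shift_act mark_prod L =1 (fun=> 0).
Proof.
move=> Lqp LE; apply: (@quasi_polynomial_eq0 _ _ (size mark_prod)).
  exact: quasi_polynomial_shift_act.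
move=> q ltq; rewrite (shift_act_far LE); last by lia.
by rewrite mark_prod_nsol /delta0; case: eqP => // q0; lia.
Qed.

End SolutionCount.

(** * The dilation identity *)

Section RootsOfUnity.
Variable C : numClosedFieldType.

Lemma prim_root_exists n : (0 < n)%N -> exists z : C, n.-primitive_root z.
Proof.
pose p : {poly C} := 'X^n - 1; have [r Dp] := closed_field_poly_normal p.
move=> n_gt0; rewrite (monicP _) ?monicXnsubC // scale1r in Dp.
have rn1 : all n.-unity_root r by apply/allP=> z; rewrite -root_prod_XsubC -Dp.
have sz_r : (n < (size r).+1)%N.
  by rewrite -(size_prod_XsubC r id) -Dp size_XnsubC.
have [|z] := hasP (has_prim_root n_gt0 rn1 _ sz_r); last by exists z.
by rewrite -separable_prod_XsubC -Dp separable_Xn_sub_1 // pnatr_eq0 -lt0n.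
Qed.

Lemma dvdp_1subXn n (P : {poly C}) : (0 < n)%N ->
  (forall z, z ^+ n = 1 -> root P z) -> (1 - 'X^n) %| P.
Proof.
move=> n_gt0 rootP; have [z zn] := prim_root_exists n_gt0.
rewrite -opprB dvdpNl -(factor_Xn_sub_1 zn).
rewrite -(big_map (fun i => z ^+ i) xpredT (fun x => 'X - x%:P)).
apply: uniq_roots_dvdp.
  apply/allP => _ /mapP[i _ ->]; apply: rootP.
  by rewrite exprAC (prim_expr_order zn) expr1n.
rewrite uniq_rootsE map_inj_in_uniq ?iota_uniq // => i j.
rewrite !mem_index_iota => lti ltj /eqP; rewrite (eq_prim_root_expr zn) !modn_small //.
by move/eqP.
Qed.

Lemma qint_mul_sub1 c (x : {poly C}) : (1 - x) * qint c x = 1 - x ^+ c.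
Proof. by rewrite -[in RHS]opprB subrX1 -mulNr opprB. Qed.

Lemma comp_poly_1subXn c (q : {poly C}) : (1 - 'X^c) \Po q = 1 - q ^+ c.
Proof. by rewrite comp_polyB -[1]/(1%:P) comp_polyC rmorphXn /= comp_polyX. Qed.

Lemma comp_poly_qint c k (q : {poly C}) : qint c 'X^k \Po q = qint c (q ^+ k).
Proof.
rewrite /qint rmorph_sum /=; apply: eq_bigr => i _.
by rewrite !rmorphXn /= comp_polyX.
Qed.

(* A c-th root of unity z is a root of 1 - X^g if z^N = 1, and otherwise of
   [c]_{X^N}, because then (1 - z^N) [c]_{z^N} = 1 - z^(N c) = 0. *)
Lemma dvdp_qint_gcd c N g : (0 < c)%N -> (gcdn N c %| g)%N ->
  (1 - 'X^c) %| qint c ('X^N : {poly C}) * (1 - 'X^g).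
Proof.
move=> c_gt0 gcd_g; apply: dvdp_1subXn => // z zc.
rewrite rootM; have [zN|zN] := eqVneq (z ^+ N) 1.
  apply/orP; right; rewrite rootE !hornerE; apply/eqP.
  suff zgcd : z ^+ gcdn N c = 1.
    by move/dvdnP: gcd_g => [q ->]; rewrite mulnC exprM zgcd expr1n subrr.
  (* Bezout: z^N = z^c = 1 forces z^gcd(N, c) = 1. *)
  have [km kn e _] := egcdnP N c_gt0.
  have := congr1 (fun i => z ^+ i) e; rewrite exprD mulnC exprM zc expr1n.
  by rewrite mulnC exprM zN expr1n mul1r gcdnC => <-.
apply/orP; left; rewrite rootE; apply/eqP.
have := congr1 (horner^~ z) (qint_mul_sub1 c 'X^N).
rewrite /= hornerM !hornerE -exprM mulnC exprM zc expr1n subrr => /eqP.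
by rewrite mulf_eq0 subr_eq0 eq_sym (negPf zN) => /eqP.
Qed.

End RootsOfUnity.

Section DilationIdentity.
Variables (C : numClosedFieldType) (J : finType) (m : J -> nat) (d : nat).
Hypothesis m_gt0 : forall j, (0 < m j)%N.

Local Notation N := (nsol C m).
Local Notation D := (mark_prod C m).

(** Some P = (1 - X^p)^k kills L, so P(S) N has finite support and D divides P. A primitive root of
    unity of order m_j is then a root of 1 - X^p. *)
Lemma mark_dvd_period L p : is_period L p ->
  (forall t : int, 1 <= t -> L t = N t) -> forall j, (m j %| p)%N.
Proof.
move=> Lp LE j; have p_gt0 := Lp.1.
have [k Lk] := period_annihilated Lp; pose P : {poly C} := (1 - 'X^p) ^+ k.
have eqP' : P = D * \poly_(i < size P) shift_act P N i.
  apply: shift_act_delta0_inj => t.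
  transitivity (shift_act D (shift_act P N) t).
    rewrite -shift_actM mulrC shift_actM; apply: eq_shift_act => s.
    by rewrite mark_prod_nsol.
  rewrite shift_actM; apply: eq_shift_act; apply: finite_support_poly => s lt_s.
    by rewrite /shift_act big1 // => i _; case E: (_ - _) => [n|n]; rewrite ?mulr0 //; lia.
  by rewrite -(shift_act_far LE) ?Lk.
have [z zj] := prim_root_exists C (m_gt0 j).
have : root P z.
  rewrite eqP' rootM /mark_prod (bigD1 j) //= rootM rootE.
  by rewrite !hornerE (prim_expr_order zj) subrr eqxx.
rewrite rootE !hornerE expf_eq0 => /andP[_]; rewrite subr_eq0 eq_sym.
by rewrite -(prim_order_dvd zj).
Qed.

Definition pos_power (t : int) : C := if 0 < t then t%:~R ^+ d else 0.

(** On generating functions, this is the substitution of X^mu for X. *)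
Definition dilate (mu : nat) (f : int -> C) (t : int) : C :=
  if (mu%:Z %| t)%Z then f (t %/ mu)%Z else 0.

Lemma shift_act_dilate mu P f : (0 < mu)%N ->
  shift_act (P \Po 'X^mu) (dilate mu f) =1 dilate mu (shift_act P f).
Proof.
move=> mu_gt0 t; rewrite shift_act_compXn /dilate.
have dvdE k : (mu%:Z %| t - (mu * k)%:Z)%Z = (mu%:Z %| t)%Z.
  by rewrite rpredBr // PoszM dvdz_mulr.
case: ifPn => [/dvdzP[s ->]|ndvd]; last first.
  by rewrite big1 // => k _; rewrite dvdE (negPf ndvd) mulr0.
apply: eq_bigr => k _; rewrite PoszM [_ * k%:Z]mulrC -mulrBl dvdz_mull //.
by rewrite !mulzK //; lia.
Qed.

Lemma dilate_delta0 mu : (0 < mu)%N -> dilate mu (delta0 C) =1 delta0 C.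
Proof.
move=> mu_gt0 t; rewrite /dilate /delta0; case: ifPn => [/dvdzP[s ->]|].
  by rewrite mulzK ?mulf_eq0; [case: eqP; case: eqP => //; lia | lia].
by case: eqP => // ->; rewrite dvdz0.
Qed.

Lemma sum_dvd_residues mu t : (0 < mu)%N ->
  \sum_(k < mu) (mu%:Z %| t - k%:Z)%Z%:R = 1 :> C.
Proof.
move=> mu_gt0; have mu0 : mu%:Z != 0 by lia.
have ltr : (`|(t %% mu)%Z| < mu)%N by rewrite -ltz_nat gez0_abs ?modz_ge0 // ltz_pmod.
rewrite (bigD1 (Ordinal ltr)) //= big1 ?addr0.
  by rewrite gez0_abs ?modz_ge0 // -eqz_mod_dvd modz_mod eqxx.
move=> k nek; rewrite -eqz_mod_dvd (modz_small (m := k%:Z)); last by have := ltn_ord k; lia.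
case: eqP => // e; case/eqP: nek; apply/val_inj => /=.
by rewrite e.
Qed.

Hypothesis card_J : #|J| = d.+1.

Lemma dilation_quotient (Rp : {poly C}) mu : (0 < mu)%N ->
  shift_act Rp N =1 pos_power ->
  exists v, (Rp \Po 'X^mu) - (\prod_j ((mu%:R)^-1 *: qint mu 'X^(m j))) * Rp =
    (\prod_j (qint (m j) 'X^mu * (1 - 'X))) * v.
Proof.
move=> mu_gt0 RpN; have mu0 : mu%:R != 0 :> C by rewrite pnatr_eq0 -lt0n.
pose E : {poly C} := \prod_j (1 - 'X^(mu * m j)).
have RpE : shift_act Rp (delta0 C) =1 shift_act D pos_power.
  move=> t; rewrite -(eq_shift_act _ RpN) -shift_actM mulrC shift_actM.
  by apply: eq_shift_act => s; rewrite mark_prod_nsol.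
have compE : shift_act (Rp \Po 'X^mu) (delta0 C) =1 shift_act E (dilate mu pos_power).
  move=> t; rewrite -(eq_shift_act _ (dilate_delta0 mu_gt0)) shift_act_dilate //.
  transitivity (dilate mu (shift_act D pos_power) t).
    by rewrite /dilate; case: ifP.
  rewrite -shift_act_dilate // /mark_prod rmorph_prod /=; congr (shift_act _ _ _).
  by apply: eq_bigr => j _; rewrite comp_poly_1subXn -exprM.
(* The constant collects one factor 1/mu for each of the d + 1 elements of [J]. *)
pose e t := dilate mu pos_power t - (mu%:R^-1) ^+ d.+1 * pos_power t.
set T := _ - _; have TE : shift_act T (delta0 C) =1 shift_act E e.
  move=> t; rewrite /T shift_actB compE shift_act_funB shift_act_funZ; congr (_ - _).
  rewrite shift_actM (eq_shift_act _ RpE) -shift_actM -shift_actZ.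
  congr (shift_act _ _ _); rewrite -mul_polyC polyC_exp -card_J -prodr_const -!big_split /=.
  apply: eq_bigr => j _.
  by rewrite -scalerAl mulrC qint_mul_sub1 -exprM mulnC mul_polyC.
(* One factor [mu]_S sums over mu consecutive integers, exactly one of which is a multiple of mu,
   and so kills [mu | t] - 1/mu; each of the d factors t takes one more. *)
pose W : {poly C} := qint mu 'X ^+ d.+1.
pose del t : C := mu%:R^-1 ^+ d * ((mu%:Z %| t)%Z%:R - mu%:R^-1).
have Wdel t : shift_act W (fun s => s%:~R ^+ d * del s) t = 0.
  apply: shift_act_expn_mulid => {}t; rewrite shift_act_funZ /qint.
  rewrite shift_act_sum (eq_bigr (fun k : 'I_mu => (mu%:Z %| t - k%:Z)%Z%:R - mu%:R^-1)).
    rewrite sumrB sum_dvd_residues // sumr_const card_ord -(mulr_natr mu%:R^-1) mulVf //.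
    by rewrite subrr mulr0.
  by move=> k _; rewrite shift_actXn.
have eE (t : int) : 1 <= t -> e t = t%:~R ^+ d * del t.
  move=> t_gt0; rewrite /e /dilate /pos_power /del exprSr.
  have -> : (0 < t) by lia.
  case: ifPn => [/dvdzP[s ts]|_]; last by rewrite /=; ring.
  rewrite ts mulzK; last by lia.
  have -> : 0 < s by move: t_gt0; rewrite ts; nia.
  by rewrite intrM exprMn exprVn /= -[mu%:~R]/(mu%:R); field; rewrite expf_neq0 mu0.
(* For such t only positive arguments of [e] enter, where the formula [eE] applies. *)
have We (t : int) : (size W)%:Z <= t -> shift_act W e t = 0.
  by move=> let_; rewrite (shift_act_far eE).
have e_neg (t : int) : t < 0 -> e t = 0.
  move=> t0; rewrite /e /dilate /pos_power.
  have -> : (0 < t) = false by lia.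
  have -> : (0 < (t %/ mu)%Z) = false.
    apply/negbTE; rewrite -leNgt.
    have : (t %/ mu)%Z * mu%:Z <= t by rewrite lez_floor //; lia.
    by move: (t %/ mu)%Z => q; nia.
  by rewrite if_same mulr0 subrr.
have We_neg (t : int) : t < 0 -> shift_act W e t = 0.
  by move=> t0; rewrite /shift_act big1 // => i _; rewrite e_neg ?mulr0 //; lia.
have WE := finite_support_poly We_neg We; set v := \poly_(_ < _) _ in WE.
(* Factorwise, 1 - X^(mu m_j) = [m_j]_(X^mu) (1 - X) [mu]_X. *)
have EW : E = (\prod_j (qint (m j) 'X^mu * (1 - 'X))) * W.
  rewrite /E /W -card_J -prodr_const -big_split; apply: eq_bigr => j _ /=.
  by rewrite -mulrA qint_mul_sub1 mulrC qint_mul_sub1 -exprM.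
have W0 : W != 0.
  rewrite expf_neq0 //; apply: contraTneq mu_gt0 => q0.
  have := qint_mul_sub1 mu ('X : {poly C}); rewrite q0 mulr0 => /esym/eqP.
  rewrite subr_eq0 eq_sym => /eqP/(congr1 (fun p : {poly C} => size p)).
  by rewrite size_polyXn size_poly1 => -[->].
(* After multiplication by W, both sides have the coefficient sequence E(S) W(S) e. *)
exists v; apply: (mulfI W0); rewrite [RHS]mulrCA [RHS]mulrA -EW.
apply: shift_act_delta0_inj => t; rewrite !shift_actM (eq_shift_act _ TE).
by rewrite -shift_actM mulrC shift_actM (eq_shift_act _ WE).
Qed.

(** Substituting X^g in [dilation_quotient] turns its factors into [m_j]_(X^(n+1)) (1 - X^g). As m_j
    divides rho, gcd(n+1, m_j) divides g, so 1 - X^(m_j) divides the j-th factor and D(S) L = 0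
    kills the difference. *)
Lemma dilation_shift (Rp : {poly C}) (L : int -> C) rho n
    (g := gcdn n.+1 rho) (mu := (n.+1 %/ g)%N) :
  shift_act Rp N =1 pos_power -> shift_act D L =1 (fun=> 0) ->
  (forall j, (m j %| rho)%N) ->
  shift_act (Rp \Po 'X^(n.+1)) L =1
  shift_act (\prod_j ((mu%:R)^-1 *: qint mu 'X^(m j * g)))
    (shift_act (Rp \Po 'X^g) L).
Proof.
move=> RpN DL m_rho t.
have g_gt0 : (0 < g)%N by rewrite gcdn_gt0.
have mug : (mu * g = n.+1)%N by rewrite divnK ?dvdn_gcdl.
have mu_gt0 : (0 < mu)%N by rewrite divn_gt0 // dvdn_leq // dvdn_gcdl.
have [v /(congr1 (fun p => p \Po 'X^g))] := dilation_quotient mu_gt0 RpN.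
rewrite comp_polyB !comp_polyM -comp_polyA comp_Xn_poly -exprM mulnC mug.
rewrite !rmorph_prod /= => eqT.
rewrite -shift_actM; apply/eqP; rewrite -subr_eq0 -shift_actB.
have -> : \prod_j (mu%:R^-1 *: qint mu 'X^(m j * g)) =
    \prod_j ((mu%:R^-1 *: qint mu 'X^(m j)) \Po 'X^g) :> {poly C}.
  by apply: eq_bigr => j _; rewrite comp_polyZ comp_poly_qint mulnC exprM.
rewrite eqT; apply/eqP.
suff /dvdpP[u ->] : D %| \prod_j ((qint (m j) 'X^mu * (1 - 'X)) \Po 'X^g).
  by rewrite mulrAC shift_actM shift_act_fun0.
rewrite /mark_prod; elim/big_ind2: _ => [|p1 p2 q1 q2|j _]; first exact: dvdpp.
  exact: dvdp_mul.
rewrite comp_polyM comp_poly_qint -exprM mulnC mug -['X]expr1 comp_poly_1subXn expr1.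
apply: dvdp_qint_gcd => //; rewrite dvdn_gcd dvdn_gcdl.
exact: dvdn_trans (dvdn_gcdr _ _) (m_rho j).
Qed.

End DilationIdentity.

(** * Affine roots *)

Section DotProduct.
Variables (R : realType) (l : nat).
Local Notation V := 'rV[R]_l.
Implicit Types u v x : V.

Lemma dotC u v : dot u v = dot v u.
Proof. by apply: eq_bigr => i _; rewrite mulrC. Qed.

Lemma dotDl u v x : dot (u + v) x = dot u x + dot v x.
Proof. by rewrite -big_split; apply: eq_bigr => i _; rewrite mxE mulrDl. Qed.

Lemma dotZl a u x : dot (a *: u) x = a * dot u x.
Proof. by rewrite mulr_sumr; apply: eq_bigr => i _; rewrite mxE mulrA. Qed.

Lemma dotNl u x : dot (- u) x = - dot u x.
Proof. by rewrite -scaleN1r dotZl mulN1r. Qed.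

Lemma dotBl u v x : dot (u - v) x = dot u x - dot v x.
Proof. by rewrite dotDl dotNl. Qed.

Lemma dotDr x u v : dot x (u + v) = dot x u + dot x v.
Proof. by rewrite dotC dotDl !(dotC x). Qed.

Lemma dotZr a x u : dot x (a *: u) = a * dot x u.
Proof. by rewrite dotC dotZl (dotC x). Qed.

Lemma dotBr x u v : dot x (u - v) = dot x u - dot x v.
Proof. by rewrite dotC dotBl !(dotC x). Qed.

Lemma dot0l x : dot 0 x = 0.
Proof. by rewrite -(scale0r 0) dotZl mul0r. Qed.

Lemma dot_suml (I : Type) (r : seq I) (P : pred I) (F : I -> V) x :
  dot (\sum_(i <- r | P i) F i) x = \sum_(i <- r | P i) dot (F i) x.
Proof.
elim/big_rec2: _ => [|i a u _ <-]; [exact: dot0l | exact: dotDl].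
Qed.

Lemma dotMnl u k x : dot (u *+ k) x = dot u x *+ k.
Proof. by rewrite -scaler_nat dotZl mulr_natl. Qed.

Lemma dotMnr x u k : dot x (u *+ k) = dot x u *+ k.
Proof. by rewrite dotC dotMnl dotC. Qed.

Lemma dot_ge0 u : 0 <= dot u u.
Proof. by apply: sumr_ge0 => i _; rewrite -expr2 sqr_ge0. Qed.

Lemma dot_eq0 u : (dot u u == 0) = (u == 0).
Proof.
rewrite psumr_eq0; last by move=> i _; rewrite -expr2 sqr_ge0.
apply/allP/eqP => [u0|-> i _]; last by rewrite mxE mulr0 eqxx.
apply/rowP => i; rewrite mxE; apply/eqP.
by have := u0 i (mem_index_enum i); rewrite -expr2 sqrf_eq0.
Qed.

Lemma dot_gt0 u : u != 0 -> 0 < dot u u.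
Proof. by move=> u0; rewrite lt_def dot_eq0 u0 dot_ge0. Qed.

Lemma dot_coordinates (b : 'I_l -> V) :
  (forall x, (forall j, dot (b j) x = 0) -> x = 0) ->
  forall z : 'I_l -> R, exists x, forall j, dot (b j) x = z j.
Proof.
move=> b_nondeg z; pose A : 'M[R]_l := \matrix_(i, j) b j 0 i.
have mulA x j : (x *m A) 0 j = dot (b j) x.
  by rewrite mxE dotC; apply: eq_bigr => i _; rewrite mxE.
have A_unit : A \in unitmx.
  rewrite -row_free_unit; apply: inj_row_free => x xA0; apply: b_nondeg => j.
  by rewrite -mulA xA0 mxE.
exists ((\row_j z j) *m invmx A) => j.
by rewrite -mulA mulmxKV // mxE.
Qed.

End DotProduct.

Section AffineRoots.
Variables (R : realType) (l : nat).
Local Notation V := 'rV[R]_l.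
Implicit Types u v g : V * R^o.

(* The pair u stands for the affine function x |-> (u.1, x) + u.2, and aff_eval
   evaluates its q-th dilate. *)
Definition aff_eval (q : R) (x : V) u : R := dot u.1 x + q * u.2.

(** The affine function u composed with the reflection in the hyperplane g = 0; constants are
    fixed. *)
Definition aff_refl g u := u - (2 * dot g.1 u.1 / dot g.1 g.1) *: g.

Lemma aff_evalD q x u v : aff_eval q x (u + v) = aff_eval q x u + aff_eval q x v.
Proof. by rewrite /aff_eval /= dotDl; ring. Qed.

Lemma aff_evalN q x u : aff_eval q x (- u) = - aff_eval q x u.
Proof. by rewrite /aff_eval /= dotNl; ring. Qed.

Lemma aff_evalMn q x u k : aff_eval q x (u *+ k) = aff_eval q x u *+ k.
Proof.
elim: k => [|k IHk]; first by rewrite !mulr0n /aff_eval /= dot0l mulr0 addr0.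
by rewrite !mulrS aff_evalD IHk.
Qed.

Lemma aff_eval_sum q x n (L : 'I_n -> V * R^o) (a : 'I_n -> nat) :
  aff_eval q x (\sum_j L j *+ a j) = \sum_j aff_eval q x (L j) *+ a j.
Proof.
rewrite (big_morph (aff_eval q x) (aff_evalD q x) (aff_evalMn q x 0 0)).
by apply: eq_bigr => j _; rewrite aff_evalMn.
Qed.

Lemma aff_reflD g u v : aff_refl g (u + v) = aff_refl g u + aff_refl g v.
Proof.
rewrite /aff_refl /= dotDr mulrDr mulrDl scalerDl opprD.
by rewrite addrACA.
Qed.

Lemma aff_reflMn g u k : aff_refl g (u *+ k) = aff_refl g u *+ k.
Proof.
elim: k => [|k IHk]; last by rewrite !mulrS aff_reflD IHk.
by rewrite !mulr0n /aff_refl /= dotC dot0l mulr0 mul0r scale0r subr0.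
Qed.

Lemma aff_reflN g u : aff_refl g (- u) = - aff_refl g u.
Proof.
apply/eqP; rewrite -addr_eq0 -aff_reflD addNr.
by rewrite -(mulr0n 0) aff_reflMn.
Qed.

Lemma aff_refl_sum g n (L : 'I_n -> V * R^o) (a : 'I_n -> nat) :
  aff_refl g (\sum_j L j *+ a j) = \sum_j aff_refl g (L j) *+ a j.
Proof.
rewrite (big_morph (aff_refl g) (aff_reflD g) (aff_reflMn g 0 0)).
by apply: eq_bigr => j _; rewrite aff_reflMn.
Qed.

Lemma aff_reflK g : g.1 != 0 -> involutive (aff_refl g).
Proof.
move=> g0 u; have gg0 : dot g.1 g.1 != 0 by rewrite dot_eq0.
rewrite /aff_refl /= dotBr dotZr -addrA -opprD -scalerDl.
have -> : 2 * dot g.1 u.1 / dot g.1 g.1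
    + 2 * (dot g.1 u.1 - 2 * dot g.1 u.1 / dot g.1 g.1 * dot g.1 g.1) / dot g.1 g.1 = 0.
  by field.
by rewrite scale0r subr0.
Qed.

Definition point_refl q g (x : V) : V :=
  x - (2 * aff_eval q x g / dot g.1 g.1) *: g.1.

Lemma aff_eval_refl q x g u :
  aff_eval q (point_refl q g x) u = aff_eval q x (aff_refl g u).
Proof.
rewrite /point_refl /aff_refl /aff_eval /= dotBr dotZr dotBl dotZl (dotC g.1 u.1).
by rewrite /GRing.scale /=; ring.
Qed.

(* Reflecting x in a wall that separates it from y brings it closer to y. *)
Lemma dist_point_refl q g x y : g.1 != 0 ->
  dot (point_refl q g x - y) (point_refl q g x - y) =
  dot (x - y) (x - y) + 4 * aff_eval q x g * aff_eval q y g / dot g.1 g.1.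
Proof.
move=> g0; have gg0 : dot g.1 g.1 != 0 by rewrite dot_eq0.
rewrite /point_refl; set t := 2 * _ / _.
rewrite !(dotBl, dotBr, dotZl, dotZr) !(dotC x g.1) !(dotC y g.1) (dotC y x).
rewrite /t /aff_eval; field.
exact: gg0.
Qed.

End AffineRoots.

(** * Walls of alcoves *)

Section WallSystems.
Variables (R : realType) (l : nat) (Phi : {fset 'rV[R]_l}) (alpha : 'I_l -> 'rV[R]_l).
Variable c : 'I_l -> nat.
Local Notation V := 'rV[R]_l.
Local Notation theta := (\sum_(i < l) alpha i *+ c i).
Local Notation pos := (positive_roots Phi alpha).
Local Notation lattice := (coweight_lattice alpha).
Hypothesis rootsP : root_system Phi.
Hypothesis simpleP : simple_roots Phi alpha.
Hypothesis highestP : highest_root Phi alpha theta.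

Lemma simple_nondegenerate x : (forall i, dot (alpha i) x = 0) -> x = 0.
Proof.
move=> ax0; apply/eqP; rewrite -dot_eq0; apply/eqP.
have [_ /andP[/eqP span_full _] _] := simpleP.
have : x \in <<codom alpha>>%VS by rewrite span_full memvf.
move=> /(coord_span (X := in_tuple (codom alpha))) {1}->.
rewrite dot_suml big1 // => i _; rewrite dotZl.
have /codomP[k ->] : (in_tuple (codom alpha))`_i \in codom alpha.
  by apply: mem_nth; exact: ltn_ord.
by rewrite ax0 mulr0.
Qed.

Lemma simple_coordinates z : exists x, forall i, dot (alpha i) x = z i.
Proof. exact: dot_coordinates simple_nondegenerate z. Qed.

Lemma simple_root i : alpha i \in Phi.
Proof. by have [] := simpleP. Qed.

Lemma simple_pos i : pos (alpha i).
Proof.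
split; first exact: simple_root.
exists (fun j => (j == i) : nat); rewrite (bigD1 i) //= eqxx mulr1n big1 ?addr0 //.
by move=> j /negPf ->.
Qed.

Lemma root_opp b : b \in Phi -> - b \in Phi.
Proof.
move=> bP; have := rs_refl rootsP bP bP; rewrite /reflection.
have bb0 : dot b b != 0 by rewrite dot_eq0 (rs_neq0 rootsP).
by rewrite mulfK // -{1}[b]scale1r -scalerBl (_ : 1 - 2 = -1) ?scaleN1r //; ring.
Qed.

Lemma neg_root b : b \in Phi -> ~ pos b -> pos (- b).
Proof.
move=> bP nb; have [_ _ /(_ _ bP)[bC|bC]] := simpleP; first by case: nb.
by split; first exact: root_opp.
Qed.

Lemma dot_nat_comb b x : lattice x -> nat_comb alpha b -> dot b x \is a Num.int.
Proof.
move=> xL [k ->]; rewrite dot_suml rpred_sum // => i _.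
by rewrite dotMnl rpredMn //; exact: xL.
Qed.

Lemma dot_root_int b x : lattice x -> b \in Phi -> dot b x \is a Num.int.
Proof.
move=> xL bP; have [_ _ /(_ _ bP)[bC|bC]] := simpleP.
  exact: dot_nat_comb.
by rewrite -[b]opprK dotNl rpredN dot_nat_comb.
Qed.

Lemma theta_pos : pos theta. Proof. by case: highestP. Qed.

Lemma dot_theta x : dot theta x = \sum_i (c i)%:R * dot (alpha i) x.
Proof. by rewrite dot_suml; apply: eq_bigr => i _; rewrite dotMnl mulr_natl. Qed.

(** The difference theta - alpha_i has coefficients in N; pairing it with the i-th fundamental
    coweight [x] shows c_i >= 1. *)
Lemma mark_gt0 j : (0 < mark c j)%N.
Proof.
rewrite /mark; case: unliftP => [i _|//]; rewrite lt0n; apply/eqP => ci0.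
have [x ax] := simple_coordinates (fun k => (k == i)%:R).
have [_ /(_ _ (simple_pos i))[k /(congr1 (fun v => dot v x))]] := highestP.
rewrite dotBl dot_theta dot_suml.
rewrite (bigD1 i) //= ci0 mul0r add0r big1; last first.
  by move=> j' /negPf ne; rewrite ax ne mulr0.
rewrite ax eqxx sub0r => e.
have : 0 <= (-1 : R) by rewrite e; apply: sumr_ge0 => j' _; rewrite dotMnl ax mulrn_wge0.
by rewrite oppr_ge0 ler10.
Qed.

Definition affine_root (u : V * R^o) : Prop := u.1 \in Phi /\ u.2 \is a Num.int.

Definition wall_comb (L : 'I_l.+1 -> V * R^o) (u : V * R^o) : Prop :=
  exists a : 'I_l.+1 -> nat, u = \sum_j L j *+ a j.

(* The simple affine roots of an alcove, labelled by the nodes of the extended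
   Dynkin diagram. *)
Definition wall_system (L : 'I_l.+1 -> V * R^o) : Prop :=
  [/\ forall j, affine_root (L j),
      \sum_j L j *+ mark c j = (0, 1) &
      forall u, affine_root u -> wall_comb L u \/ wall_comb L (- u)].

Lemma affine_root_neq0 u : affine_root u -> u.1 != 0.
Proof. by case=> uP _; exact: (rs_neq0 rootsP). Qed.

Lemma affine_root_refl g u : affine_root g -> affine_root u -> affine_root (aff_refl g u).
Proof.
move=> [g1 g2] [u1 u2]; split; first exact: (rs_refl rootsP g1 u1).
by rewrite /= rpredB // /GRing.scale /= rpredM // (rs_cryst rootsP g1 u1).
Qed.

Lemma affine_root_eval (q : nat) x u :
  lattice x -> affine_root u -> aff_eval q%:R x u \is a Num.int.
Proof. by move=> xL [u1 u2]; rewrite rpredD ?dot_root_int // rpredM ?rpred_nat. Qed.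

(** A reflection permutes the affine roots and fixes the constant function 1, so it carries the
    walls of an alcove to those of another. *)
Lemma wall_system_refl g L :
  affine_root g -> wall_system L -> wall_system (fun j => aff_refl g (L j)).
Proof.
move=> gA [LA Lsum Lcomb]; have gK := aff_reflK (affine_root_neq0 gA).
split=> [j||u uA]; first exact: affine_root_refl.
  rewrite -aff_refl_sum Lsum /aff_refl /= dotC dot0l mulr0 mul0r scale0r.
  exact: subr0.
have [[a e]|[a e]] := Lcomb _ (affine_root_refl gA uA); [left | right]; exists a.
  by rewrite -aff_refl_sum -e gK.
by rewrite -aff_refl_sum -e aff_reflN gK.
Qed.

(** The walls of the fundamental alcove, with the affine node at 0. *)
Definition simple_walls (j : 'I_l.+1) : V * R^o :=
  if unlift ord0 j is Some i then (alpha i, 0) else (- theta, 1).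

Lemma mark_ord0 : mark c ord0 = 1%N.
Proof. by rewrite /mark unlift_none. Qed.

Lemma mark_lift i : mark c (lift ord0 i) = c i.
Proof. by rewrite /mark liftK. Qed.

Lemma simple_walls0 : simple_walls ord0 = (- theta, 1).
Proof. by rewrite /simple_walls unlift_none. Qed.

Lemma simple_walls_lift i : simple_walls (lift ord0 i) = (alpha i, 0).
Proof. by rewrite /simple_walls liftK. Qed.

Lemma sum_pair0 (b : 'I_l -> V) (k : 'I_l -> nat) :
  \sum_i (b i, 0 : R^o) *+ k i = (\sum_i b i *+ k i, 0).
Proof.
elim/big_rec2: _ => [//|i x y _ ->]; rewrite -[_ *+ k i]/((b i, 0) *+ k i).
have -> : (b i, 0 : R^o) *+ k i = (b i *+ k i, 0).
  by elim: (k i) => [//|m IHm]; rewrite !mulrS IHm /GRing.add /= /add_pair /= addr0.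
by rewrite /GRing.add /= /add_pair /= addr0.
Qed.

Lemma simple_walls_sum : \sum_j simple_walls j *+ mark c j = (0, 1).
Proof.
rewrite big_ord_recl mark_ord0 simple_walls0 mulr1n.
rewrite (eq_bigr (fun i => (alpha i, 0 : R^o) *+ c i)); last first.
  by move=> i _; rewrite simple_walls_lift mark_lift.
rewrite sum_pair0; congr (_, _); first exact: addNr.
exact: addr0.
Qed.

Lemma wall_combD L u v : wall_comb L u -> wall_comb L v -> wall_comb L (u + v).
Proof.
move=> [a ->] [b ->]; exists (fun j => a j + b j)%N.
by rewrite -big_split; apply: eq_bigr => j _; rewrite mulrnDr.
Qed.

Lemma wall_combMn L u n : wall_comb L u -> wall_comb L (u *+ n).
Proof.
move=> [a ->]; exists (fun j => a j * n)%N.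
by rewrite -sumrMnl; apply: eq_bigr => j _; rewrite mulrnA.
Qed.

Lemma wall_comb_wall L j : wall_comb L (L j).
Proof.
exists (fun i => (i == j) : nat); rewrite (bigD1 j) //= eqxx mulr1n big1 ?addr0 //.
by move=> i /negPf ->.
Qed.

Lemma wall_comb_simple b : nat_comb alpha b -> wall_comb simple_walls (b, 0).
Proof.
move=> [k ->]; exists (fun j => if unlift ord0 j is Some i then k i else 0%N).
rewrite big_ord_recl unlift_none mulr0n add0r -sum_pair0.
by apply: eq_bigr => i _; rewrite liftK simple_walls_lift.
Qed.

Lemma wall_comb_const L (k : nat) :
  \sum_j L j *+ mark c j = (0, 1) -> wall_comb L (0, k%:R).
Proof.
move=> e; have -> : (0, k%:R) = (0, 1) *+ k :> V * R^o.
  elim: k => [//|k IHk]; rewrite [RHS]mulrS -IHk -nat1r.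
  by rewrite /GRing.add /= /add_pair /= add0r.
by apply: wall_combMn; exists (mark c).
Qed.

(** For b positive and k >= 0, b + k is a sum of simple roots plus k copies of the constant 1; for k
    < 0, -(b + k) = (theta - b) + (1 - theta) + (-k - 1), where theta - b is a sum of simple
    roots. *)
Lemma wall_system_simple : wall_system simple_walls.
Proof.
have simple_comb b k : pos b -> (0 <= k) -> k \is a Num.int ->
    wall_comb simple_walls (b, k).
  move=> [_ bC] k0 kZ; have /natrP[m ->] : k \is a Num.nat by rewrite natrEint kZ.
  have -> : (b, m%:R) = (b, 0) + (0, m%:R) :> V * R^o.
    by rewrite /GRing.add /= /add_pair /= addr0 add0r.
  apply: wall_combD; first exact: wall_comb_simple.
  exact: wall_comb_const simple_walls_sum.
have opp_comb b k : pos b -> k < 0 -> k \is a Num.int ->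
    wall_comb simple_walls (- (b, k)).
  move=> bP k0 kZ; have [_ /(_ _ bP) tbC] := highestP.
  have kN : - k - 1 \is a Num.nat.
    rewrite natrEint rpredB ?rpredN ?rpred1 //= subr_ge0.
    by move/intrP: kZ k0 => [z ->]; rewrite -rmorphN /= ltrz0 ler1z; lia.
  have [m em] := natrP kN.
  have -> : - (b, k) = (theta - b, 0) + (simple_walls ord0 + (0, m%:R)) :> V * R^o.
    rewrite simple_walls0 -em; apply: injective_projections => /=; last by ring.
    by rewrite addr0 addrAC subrr add0r.
  apply: wall_combD; first exact: wall_comb_simple.
  apply: wall_combD; [exact: wall_comb_wall | exact: wall_comb_const simple_walls_sum].
split=> [j||[b k] [/= bP kZ]]; last 2 first.
- exact: simple_walls_sum.
- have opp_pair (b' : V) (k' : R^o) : - (b', k') = (- b', - k') by [].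
  have [bpos|/(neg_root bP) nbpos] := pselect (pos b); have [k0|k0] := leP 0 k.
  + by left; apply: simple_comb.
  + by right; apply: opp_comb.
  + have [->|kn0] := eqVneq k 0.
      by right; rewrite opp_pair oppr0; apply: simple_comb; rewrite ?rpred0.
    left; rewrite -[(b, k)]opprK opp_pair; apply: opp_comb; rewrite ?rpredN //.
    by rewrite oppr_lt0 lt_def kn0.
  + by right; rewrite opp_pair; apply: simple_comb; rewrite ?rpredN ?oppr_ge0 ?ltW.
rewrite /simple_walls; case: unliftP => [i _|_].
  by split; rewrite ?simple_root ?rpred0.
by split; rewrite ?rpred1 //= root_opp //; case: theta_pos.
Qed.

(** With h the Coxeter number, y is q / h times the sum of the fundamental coweights; for q > 0 it
    lies inside the dilated alcove. *)
Lemma interior_point (q : R) : exists2 h : R, 0 < h & exists y : V,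
  forall j, aff_eval q y (simple_walls j) = q / h.
Proof.
pose h : R := 1 + \sum_i (c i)%:R.
have h_gt0 : 0 < h.
  by rewrite ltr_pwDl // sumr_ge0 // => i _; rewrite ler0n.
exists h => //; have [y ay] := simple_coordinates (fun=> q / h); exists y => j.
case: (unliftP ord0 j) => [i|] ->.
  by rewrite simple_walls_lift /aff_eval /= ay mulr0 addr0.
rewrite simple_walls0 /aff_eval /= dotNl dot_theta.
rewrite (eq_bigr (fun i => (c i)%:R * (q / h))); last by move=> i _; rewrite ay.
rewrite -mulr_suml; have -> : \sum_i (c i)%:R = h - 1 :> R by rewrite /h; ring.
by field; rewrite gt_eqF.
Qed.

(** [g] is integral at lattice points, and its normal pairs with the simple roots through Cartan
    integers. *)
Lemma point_refl_lattice (q : nat) g x :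
  affine_root g -> lattice x -> lattice (point_refl q%:R g x).
Proof.
move=> gA xL i; rewrite /point_refl dotBr dotZr.
apply: rpredB; first exact: (xL i).
have -> : 2 * aff_eval q%:R x g / dot g.1 g.1 * dot (alpha i) g.1 =
    aff_eval q%:R x g * (2 * dot g.1 (alpha i) / dot g.1 g.1).
  by rewrite (dotC (alpha i)); ring.
by rewrite rpredM ?affine_root_eval // (rs_cryst rootsP gA.1 (simple_root i)).
Qed.

(** Reflecting x in walls that separate it from the interior point y brings it into the fundamental
    alcove; undoing the reflections moves the walls to x. The descent stops because each reflection
    lowers the squared distance to y by at least [step]. *)
Lemma chamber_exists (q : nat) x : (0 < q)%N -> lattice x ->
  exists2 L, wall_system L & forall j, 0 <= aff_eval q%:R x (L j).
Proof.
move=> q_gt0 xL; have qR : 0 < q%:R :> R by rewrite ltr0n.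
have [h h_gt0 [y yE]] := interior_point q%:R.
have [simpleA _ _] := wall_system_simple.
pose B := \sum_j dot (simple_walls j).1 (simple_walls j).1.
have leB j : dot (simple_walls j).1 (simple_walls j).1 <= B.
  by rewrite /B (bigD1 j) //= lerDl sumr_ge0 // => i _; apply: dot_ge0.
have wall_gt0 j : 0 < dot (simple_walls j).1 (simple_walls j).1.
  by rewrite dot_gt0 // (affine_root_neq0 (simpleA j)).
have B_gt0 : 0 < B := lt_le_trans (wall_gt0 ord0) (leB ord0).
(* The lower bound for -4 g(x) g(y) / (g, g), given g(x) <= -1 by integrality, g(y) = q / h and (g,
   g) <= B. *)
pose step := 4 * (q%:R / h) / B.
have step_gt0 : 0 < step by rewrite !(divr_gt0, mulr_gt0).
have [n] : exists n : nat, dot (x - y) (x - y) < n%:R * step.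
  exists (Num.bound (dot (x - y) (x - y) / step)).
  by rewrite -ltr_pdivrMr //; apply: archi_boundP; rewrite divr_ge0 ?dot_ge0 ?ltW.
elim: n x xL => [|n IHn] x xL; first by rewrite mul0r ltNge dot_ge0.
move=> lt_dist; have [x_ge0|] := pselect (forall j, 0 <= aff_eval q%:R x (simple_walls j)).
  by exists simple_walls => //; exact: wall_system_simple.
move=> /existsNP[j /negP]; rewrite -ltNge => neg_j.
set g := simple_walls j in neg_j; have gA : affine_root g := simpleA j.
have neg1 : aff_eval q%:R x g <= -1.
  have /intrP[z ez] := affine_root_eval q xL gA.
  by move: neg_j; rewrite ez ltrz0 -[-1]/((-1)%:~R) ler_int; lia.
have [|L' L'W L'x] := IHn _ (point_refl_lattice q gA xL).
  rewrite dist_point_refl ?(affine_root_neq0 gA) // yE.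
  apply: (@le_lt_trans _ _ (dot (x - y) (x - y) - step)); last first.
    by move: lt_dist; rewrite -natr1 mulrDl mul1r => lt_dist; lra.
  rewrite lerD2l /step -mulNr; apply: (@le_trans _ _ (- (4 * (q%:R / h)) / dot g.1 g.1)).
    rewrite ler_pM2r ?invr_gt0 ?wall_gt0 //.
    have := divr_gt0 qR h_gt0; move: (q%:R / h) (aff_eval _ _ _) neg1 => r e.
    by move=> e1 r0; rewrite mulrAC -[X in _ <= - X]mulr1 -mulrN ler_pM2l ?mulr_gt0.
  rewrite !mulNr lerN2 ler_pM2l; last by rewrite mulr_gt0 ?divr_gt0.
  by rewrite lef_pV2 ?posrE ?wall_gt0 ?leB.
exists (fun i => aff_refl g (L' i)); first exact: wall_system_refl.
by move=> i; rewrite -aff_eval_refl.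
Qed.

Lemma wall_eval_sum L (q : R) x : wall_system L ->
  \sum_j aff_eval q x (L j) *+ mark c j = q.
Proof.
by case=> _ e _; rewrite -aff_eval_sum e /aff_eval /= dot0l add0r mulr1.
Qed.

Lemma wall_comb_int L (q : R) x u : wall_comb L u ->
  (forall j, aff_eval q x (L j) \is a Num.int) -> aff_eval q x u \is a Num.int.
Proof.
by move=> [a ->] Lint; rewrite aff_eval_sum rpred_sum // => j _; rewrite rpredMn.
Qed.

(** The l walls other than node 0 are coordinates, and the value at node 0 follows from the relation
    among all walls because c_0 = 1. Each alpha_i is, up to sign, a combination of the walls, which
    makes x integral. *)
Lemma wall_coordinates L (q : nat) (z : 'I_l.+1 -> nat) : wall_system L ->
  (\sum_j mark c j * z j = q)%N ->
  exists2 x, lattice x & forall j, aff_eval q%:R x (L j) = (z j)%:R.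
Proof.
move=> LW zq; have [LA Lsum Lcomb] := LW.
have simpleA i : affine_root (alpha i, 0) by split; rewrite ?simple_root ?rpred0.
(* Evaluation at scale 0 keeps only the linear parts. *)
have nondeg x : (forall i, dot (L (lift ord0 i)).1 x = 0) -> x = 0.
  move=> Lx0; have L0 j : aff_eval 0 x (L j) = 0.
    rewrite /aff_eval mul0r addr0; case: (unliftP ord0 j) => [i|] ->; first exact: Lx0.
    have := wall_eval_sum 0 x LW; rewrite big_ord_recl mark_ord0 mulr1n.
    rewrite big1 ?addr0 => [|i _]; first by rewrite /aff_eval mul0r addr0.
    by rewrite /aff_eval Lx0 mul0r addr0 mul0rn.
  have comb0 u : wall_comb L u -> aff_eval 0 x u = 0.
    by move=> [a ->]; rewrite aff_eval_sum big1 // => j _; rewrite L0 mul0rn.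
  apply: simple_nondegenerate => i.
  have -> : dot (alpha i) x = aff_eval 0 x (alpha i, 0) by rewrite /aff_eval mul0r addr0.
  case: (Lcomb _ (simpleA i)) => /comb0 //.
  by rewrite aff_evalN => /eqP; rewrite oppr_eq0 => /eqP.
have [x xE] := dot_coordinates nondeg
  (fun i => (z (lift ord0 i))%:R - q%:R * (L (lift ord0 i)).2).
have evE j : aff_eval q%:R x (L j) = (z j)%:R.
  case: (unliftP ord0 j) => [i|] ->; first by rewrite /aff_eval xE subrK.
  have := wall_eval_sum q%:R x LW; rewrite big_ord_recl mark_ord0 mulr1n.
  rewrite (eq_bigr (fun i => (mark c (lift ord0 i) * z (lift ord0 i))%:R)); last first.
    by move=> i _; rewrite /aff_eval xE subrK natrM mulr_natl.
  rewrite -natr_sum -[RHS](congr1 (fun k => k%:R) zq) big_ord_recl mark_ord0 mul1n natrD.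
  by move/addIr.
exists x => // i; have intL j : aff_eval q%:R x (L j) \is a Num.int by rewrite evE rpred_nat.
have -> : dot (alpha i) x = aff_eval q%:R x (alpha i, 0) by rewrite /aff_eval mulr0 addr0.
case: (Lcomb _ (simpleA i)) => /wall_comb_int/(_ intL) //.
by rewrite aff_evalN rpredN.
Qed.

Lemma wall_eval_inj L (q : R) x y : wall_system L ->
  (forall j, aff_eval q x (L j) = aff_eval q y (L j)) -> x = y.
Proof.
move=> [_ _ Lcomb] Lxy; apply/eqP; rewrite -subr_eq0; apply/eqP.
apply: simple_nondegenerate => i; rewrite dotBr; apply/eqP; rewrite subr_eq0; apply/eqP.
have comb_eq u : wall_comb L u -> aff_eval q x u = aff_eval q y u.
  by move=> [a ->]; rewrite !aff_eval_sum; apply: eq_bigr => j _; rewrite Lxy.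
have evE w : dot (alpha i) w = aff_eval q w (alpha i, 0) by rewrite /aff_eval mulr0 addr0.
rewrite !evE; case: (Lcomb (alpha i, 0)) => [|/comb_eq //|/comb_eq].
  by split; rewrite ?simple_root ?rpred0.
by rewrite !aff_evalN => /oppr_inj.
Qed.

(** The values y_j + s_j of the walls at x parametrize these points, y running over the solutions
    for q - sum_j c_j s_j. If that number is negative, there are no points and [nsol] is 0. *)
Lemma card_wall_points (C : numFieldType) L (q : nat) (s : 'I_l.+1 -> nat) :
  wall_system L ->
  (set_card [set x | lattice x /\ forall j, (s j)%:R <= aff_eval q%:R x (L j)]%classic)%:R
    = nsol C (mark c) (q%:Z - (\sum_j mark c j * s j)%:Z).
Proof.
move=> LW; set A := [set x | _]%classic; set S := (\sum_j _)%N.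
have [leSq|ltqS] := leqP S q; last first.
  rewrite (_ : _ - _ = Negz (S - q).-1); last by lia.
  suff -> : A = set0 by rewrite /set_card fset_set0 cardfs0.
  apply/seteqP; split=> // x [_ xs]; have := wall_eval_sum q%:R x LW.
  move=> e; have : (S%:R : R) <= q%:R; last by rewrite ler_nat leqNgt ltqS.
  rewrite -e /S natr_sum; apply: ler_sum => j _; rewrite natrM mulr_natl.
  by rewrite ler_wMn2r.
rewrite subzn //=; congr (_%:R); set k := (q - S)%N; rewrite (card_solutions mark_gt0 (ltnSn k)).
have /choice[X XE] : forall y : {ffun 'I_l.+1 -> 'I_k.+1}, exists x,
    (\sum_j mark c j * y j == k)%N ->
    lattice x /\ forall j, aff_eval q%:R x (L j) = (y j + s j)%:R.
  move=> y; case: eqP => [yk|_]; last by exists 0.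
  have [|x xL xE] := @wall_coordinates L q (fun j => y j + s j)%N LW; last by exists x.
  transitivity (\sum_j mark c j * y j + S)%N; last by rewrite yk subnK.
  by rewrite -big_split; apply: eq_bigr => j _; rewrite mulnDr.
apply: (@set_card_param _ _ [pred y | _] X).
- move=> y z /XE[_ yE] /XE[_ zE] eXyz; apply/ffunP => j; apply/val_inj => /=.
  by have := yE j; rewrite eXyz zE => /eqP; rewrite eqr_nat eqn_add2r => /eqP.
- by move=> y /XE[xL xE]; split=> // j; rewrite xE ler_nat leq_addl.
move=> x [xL xs]; have [LA _ _] := LW.
have /choice[y yE] : forall j, exists y : nat, aff_eval q%:R x (L j) = (y + s j)%:R.
  move=> j; have : aff_eval q%:R x (L j) - (s j)%:R \is a Num.nat.
    by rewrite natrEint subr_ge0 xs andbT rpredB ?rpred_nat // affine_root_eval.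
  by case/natrP=> y e; exists y; rewrite natrD -e subrK.
have yk : (\sum_j mark c j * y j = k)%N.
  apply/eqP; rewrite -(eqn_add2r S) subnK // -big_split /= -(eqr_nat R) natr_sum.
  rewrite -[X in _ == X](wall_eval_sum q%:R x LW); apply/eqP; apply: eq_bigr => j _.
  by rewrite yE -mulnDr natrM mulr_natl.
have lty j : (y j < k.+1)%N.
  rewrite ltnS -yk (bigD1 j) //=; apply: leq_trans (leq_addr _ _).
  by rewrite leq_pmull ?mark_gt0.
pose Y : {ffun 'I_l.+1 -> 'I_k.+1} := [ffun j => Ordinal (lty j)].
have PY : (\sum_j mark c j * Y j == k)%N.
  by apply/eqP; rewrite -[RHS]yk; apply: eq_bigr => j _; rewrite ffunE.
exists Y => //; have [_ XY] := XE _ PY.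
by apply: (@wall_eval_inj L q%:R) => // j; rewrite XY yE ffunE.
Qed.

(** * The Worpitzky partition *)

Local Notation h := (\sum_(i < l) c i).+1.

Lemma pos_root b : pos b -> b \in Phi. Proof. by case. Qed.

Lemma dot_pos_root_ge1 b x : pos b -> (forall i, 1 <= dot (alpha i) x) -> 1 <= dot b x.
Proof.
move=> [bP [k e]] x_ge1; have b0 := rs_neq0 rootsP bP; rewrite e dot_suml.
have [[i ki]|k0] := pselect (exists i, k i != 0%N); last first.
  case/eqP: b0; rewrite e big1 // => i _; have [->//|ki] := eqVneq (k i) 0%N.
  by case: k0; exists i.
rewrite (bigD1 i) //= dotMnl -[1]addr0; apply: lerD.
  by apply: (le_trans (x_ge1 i)); rewrite -{1}[dot _ _]mulr1n ler_wpMn2l // ?lt0n //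
    (le_trans ler01).
apply: sumr_ge0 => j _; rewrite dotMnl mulrn_wge0 //.
exact: le_trans ler01 (x_ge1 j).
Qed.

Lemma dot_pos_root_le b x : pos b -> (forall i, 0 <= dot (alpha i) x) ->
  dot b x <= dot theta x.
Proof.
move=> bP x_ge0; have [_ /(_ _ bP)[k e]] := highestP.
rewrite -subr_ge0 -dotBl e dot_suml sumr_ge0 // => i _.
by rewrite dotMnl mulrn_wge0.
Qed.

(** Pairing with the sum w of the fundamental coweights gives the height of a root, at most h - 1
    for the highest root. *)
Lemma height_point : exists2 w, lattice w & forall b, pos b -> 1 <= dot b w < h%:R.
Proof.
have [w w1] := simple_coordinates (fun=> 1); exists w.
  by move=> i; rewrite w1 rpred1.
move=> b bP; rewrite dot_pos_root_ge1 => // [/=|i]; last by rewrite w1.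
apply: le_lt_trans (dot_pos_root_le bP _) _ => [i|]; first by rewrite w1.
rewrite dot_theta (eq_bigr (fun i => (c i)%:R)) => [|i _]; last by rewrite w1 mulr1.
by rewrite -natr_sum ltr_nat.
Qed.

(* Up to scaling by q, the points x with f b = ceil ((b, x) / q) for every
   positive root b form an alcove with its upper walls included and its lower
   walls excluded; n > 0 moves the lower walls inwards. *)
Definition in_class (q n : nat) (x : V) (f : V -> int) : Prop :=
  forall b, pos b ->
    (f b - 1)%:~R * q%:R + n.+1%:R <= dot b x <= (f b)%:~R * q%:R.

(** [L] bounds the alcove f b - 1 <= (b, x) <= f b: the second clause derives these inequalities
    from the walls, the last two derive the walls from them. *)
Definition adapted (L : 'I_l.+1 -> V * R^o) (f : V -> int) : Prop :=
  [/\ wall_system L,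
      forall b, pos b ->
        wall_comb L (b, (1 - f b)%:~R) /\ wall_comb L (- b, (f b)%:~R),
      forall j, pos (L j).1 -> (1 - f (L j).1)%:~R <= (L j).2 &
      forall j, ~ pos (L j).1 -> (f (- (L j).1))%:~R <= (L j).2].

(* The alcove containing h x - w at scale h q, where w is generic and so close
   to 0 relative to h that no positive root changes class. *)
Lemma exists_adapted q x f : (0 < q)%N -> lattice x -> in_class q 0 x f ->
  exists L, adapted L f.
Proof.
move=> q_gt0 xL xf; have [w wL wP] := height_point.
have qR : 0 < q%:R :> R by rewrite ltr0n.
have hR : 0 < h%:R :> R by rewrite ltr0n.
have yL : lattice (h%:R *: x - w).
  move=> i; rewrite dotBr dotZr; apply: rpredB; last exact: (wL i).
  by apply: rpredM; [exact: rpred_nat | exact: (xL i)].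
have hq_gt0 : (0 < h * q)%N by rewrite muln_gt0.
have [L LW Ly] := chamber_exists hq_gt0 yL.
have [LA _ Lcomb] := LW.
(* For an integer D and a positive root b, h D - (b, w) is positive iff D >= 1, and h D + (b, w) is
   positive iff D >= 0. So a point with (b, x) a multiple of q counts as below that hyperplane. *)
have evE u : aff_eval (h * q)%:R (h%:R *: x - w) u =
    h%:R * (dot u.1 x + q%:R * u.2) - dot u.1 w.
  by rewrite /aff_eval dotBr dotZr natrM; ring.
have comb_pos u : affine_root u -> 0 < aff_eval (h * q)%:R (h%:R *: x - w) u ->
    wall_comb L u.
  move=> uA u_gt0; case: (Lcomb u uA) => // -[a e].
  suff : 0 <= aff_eval (h * q)%:R (h%:R *: x - w) (- u).
    by rewrite aff_evalN oppr_ge0 leNgt u_gt0.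
  by rewrite e aff_eval_sum sumr_ge0 // => j _; rewrite mulrn_wge0.
exists L; split=> // [b bP|j jP|j jP].
- have /andP[w1 wh] := wP b bP; have /andP[xf1 xf2] := xf b bP.
  split; apply: comb_pos.
  + by split; rewrite ?pos_root ?rpred_int.
  + rewrite evE /=; set D := dot b x + _.
    have : 1 <= D by rewrite /D; move: xf1; rewrite !intrB; lra.
    by move=> D1; have := ler_wpM2l (ltW hR) D1; lra.
  + by split; rewrite ?root_opp ?pos_root ?rpred_int.
  + rewrite evE /= !dotNl; set D := _ + _ * _.
    have : 0 <= D by rewrite /D; lra.
    by move=> D1; have := mulr_ge0 (ltW hR) D1; lra.
- have /andP[w1 wh] := wP _ jP; have /andP[xf1 xf2] := xf _ jP.
  have := Ly j; rewrite evE; have [_ /intrP[m em]] := LA j; rewrite em.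
  set D := _ + _ * _ => D_ge0.
  have D_gt0 : 0 < D by rewrite -(pmulr_rgt0 _ hR); lra.
  have : 0 < (f (L j).1 + m)%:~R :> R.
    rewrite -(pmulr_lgt0 _ qR) intrD mulrDl; move: D_gt0; rewrite /D; lra.
  by rewrite ltr0z ler_int; lia.
have jN := neg_root (LA j).1 jP.
have /andP[w1 wh] := wP _ jN; have /andP[xf1 xf2] := xf _ jN.
have := Ly j; rewrite evE; have [_ /intrP[m em]] := LA j; rewrite em.
set D := _ + _ * _ => D_ge0; rewrite dotNl in wh w1 xf1 xf2.
have D_gt : -1 < D by rewrite -(ltr_pM2l hR); lra.
have : 0 < (m + 1 - f (- (L j).1))%:~R :> R.
  rewrite -(pmulr_lgt0 _ qR) intrB intrD mulrBl mulrDl mul1r.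
  by move: D_gt xf1; rewrite /D dotNl !intrB mulrBl mul1r; lra.
by rewrite ltr0z ler_int; lia.
Qed.

(** Marks the lower walls: there the affine root, nonnegative on the alcove, has a positive linear
    part. *)
Definition ascents (L : 'I_l.+1 -> V * R^o) (j : 'I_l.+1) : nat := `[< pos (L j).1 >].

Definition asc (L : 'I_l.+1 -> V * R^o) : nat := \sum_j mark c j * ascents L j.

(** From left to right, each wall is implied by one inequality of the class. Conversely, b - (f b -
    1) is a combination of walls in which a lower wall occurs, and that wall contributes the n +
    1. *)
Lemma adapted_class L f q n x : adapted L f ->
  in_class q n x f <-> forall j, (n.+1 * ascents L j)%:R <= aff_eval q%:R x (L j).
Proof.
move=> [LW Lf Lpos Lneg]; have qR : 0 <= q%:R :> R by rewrite ler0n.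
have [LA _ _] := LW; split=> [xf j|Lx b bP].
  rewrite /ascents; case: asboolP => jP; rewrite ?muln1 ?muln0.
    have /andP[xf1 _] := xf _ jP; have := ler_wpM2l qR (Lpos j jP).
    by rewrite /aff_eval; move: xf1; rewrite !intrB; lra.
  have jN := neg_root (LA j).1 jP; have /andP[_] := xf _ jN.
  have := ler_wpM2l qR (Lneg j jP); rewrite /aff_eval dotNl; lra.
have ev_ge0 j : 0 <= aff_eval q%:R x (L j) by exact: le_trans (ler0n _ _) (Lx j).
have [[a ea] [a' ea']] := Lf b bP; apply/andP; split; last first.
  have : 0 <= aff_eval q%:R x (- b, (f b)%:~R).
    by rewrite ea' aff_eval_sum sumr_ge0 // => j _; rewrite mulrn_wge0.
  by rewrite /aff_eval /= dotNl; lra.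
have [w _ wP] := height_point.
(* Otherwise b would be a combination of negative roots, contradicting (b, w) >= 1. *)
have [j /andP[aj jP]] : exists j, (0 < a j)%N && `[< pos (L j).1 >].
  apply/existsP; apply: contraT; rewrite negb_exists => /forallP noj.
  have /andP[+ _] := wP b bP; have -> : dot b w = aff_eval 0 w (b, (1 - f b)%:~R).
    by rewrite /aff_eval mul0r addr0.
  rewrite ea aff_eval_sum => /(lt_le_trans ltr01); rewrite ltNge => /negP; case.
  apply: sumr_le0 => j _; rewrite /aff_eval mul0r addr0.
  have := noj j; rewrite negb_and -eqn0Ngt => /orP[/eqP->|/asboolPn jP].
    by rewrite mulr0n.
  have /andP[+ _] := wP _ (neg_root (LA j).1 jP); rewrite dotNl => w1.
  by rewrite mulrn_wle0 //; lra.
have : n.+1%:R <= aff_eval q%:R x (b, (1 - f b)%:~R).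
  rewrite ea aff_eval_sum (bigD1 j) //= -[n.+1%:R]addr0; apply: lerD; last first.
    by apply: sumr_ge0 => i _; rewrite mulrn_wge0.
  have := Lx j; rewrite /ascents jP muln1 => /le_trans; apply.
  by rewrite -{1}[aff_eval _ _ _]mulr1n ler_wpMn2l.
by rewrite /aff_eval /= !intrB; lra.
Qed.

(** The linear parts weighted by the marks sum to 0, so they cannot all be negative roots: pair them
    with w. *)
Lemma asc_gt0 L : wall_system L -> (0 < asc L)%N.
Proof.
move=> LW; have [LA _ _] := LW; rewrite lt0n; apply/eqP => asc0.
have noj j : ~ pos (L j).1.
  move=> jP; move/eqP: asc0; rewrite /asc sum_nat_eq0 => /forallP/(_ j) /=.
  by rewrite /ascents asboolT // muln1 => /eqP m0; have := mark_gt0 j; rewrite m0.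
have [w _ wP] := height_point.
have w_lt0 j : aff_eval 0 w (L j) < 0.
  have /andP[+ _] := wP _ (neg_root (LA j).1 (noj j)).
  by rewrite /aff_eval dotNl; lra.
have := wall_eval_sum 0 w LW; rewrite big_ord_recl mark_ord0 mulr1n.
set S := \sum_(i < l) _; have : S <= 0.
  by apply: sumr_le0 => i _; rewrite mulrn_wle0 // ltW.
by have := w_lt0 ord0; lra.
Qed.

Lemma card_class (C : numFieldType) L f (q n : nat) : adapted L f ->
  (set_card [set x | lattice x /\ in_class q n x f]%classic)%:R
    = nsol C (mark c) (q%:Z - (n.+1 * asc L)%:Z).
Proof.
move=> Lf; have [LW _ _ _] := Lf; have := card_wall_points C q (fun j => n.+1 * ascents L j)%N LW.
have -> : (\sum_j mark c j * (n.+1 * ascents L j) = n.+1 * asc L)%N.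
  by rewrite /asc big_distrr; apply: eq_bigr => j _; rewrite mulnCA.
move=> <-; congr (set_card _)%:R; apply/seteqP.
by split=> x [xL xf]; split=> //; apply/(adapted_class q n x Lf).
Qed.

(** In the box, (b, x) <= (h - 1) q for every positive root b, so the ceilings of (b, x) / q stay
    below h and the cells can be indexed by a finite type. *)
Local Notation address := {ffun Phi -> 'I_h}.

Definition address_value (f : address) (b : V) : int :=
  if insub b is Some b' then (f b' : nat)%:Z else 0.

(** Fixing the values at the other roots makes an address depend only on those at positive roots. *)
Definition normalized (f : address) : Prop :=
  forall b : Phi, ~ pos (val b) -> f b = ord0.

Lemma address_valueE f (b : Phi) : address_value f (val b) = (f b : nat)%:Z.
Proof. by rewrite /address_value valK. Qed.

Lemma in_class_weaken q n x f : in_class q n x f -> in_class q 0 x f.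
Proof.
move=> xf b bP; have /andP[xf1 xf2] := xf b bP; rewrite xf2 andbT.
by apply: le_trans xf1; rewrite lerD2l ler_nat.
Qed.

Lemma in_class_uniq q x f g : in_class q 0 x f -> in_class q 0 x g ->
  forall b, pos b -> f b = g b.
Proof.
have half f' g' : in_class q 0 x f' -> in_class q 0 x g' ->
    forall b, pos b -> f' b <= g' b.
  move=> xf xg b bP; have /andP[xf1 _] := xf b bP; have /andP[_ xg2] := xg b bP.
  have : (f' b - 1)%:~R * q%:R < (g' b)%:~R * q%:R :> R by lra.
  rewrite -[q%:R]/(q%:~R) -!rmorphM /= ltr_int; nia.
by move=> xf xg b bP; apply/eqP; rewrite eq_le !half.
Qed.

Lemma address_exists q x : (0 < q)%N -> lattice x ->
  (forall i, 1 <= dot (alpha i) x <= q%:R) ->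
  exists2 f, normalized f & in_class q 0 x (address_value f).
Proof.
move=> q_gt0 xL xq; have x_ge1 i : 1 <= dot (alpha i) x by case/andP: (xq i).
have /choice[f fP] : forall b : Phi, exists k : 'I_h,
    (~ pos (val b) -> k = ord0) /\
    (pos (val b) -> (k%:Z - 1)%:~R * q%:R + 1 <= dot (val b) x <= k%:R * q%:R).
  move=> b; have [bP|nb] := pselect (pos (val b)); last by exists ord0.
  have b_ge1 := dot_pos_root_ge1 bP x_ge1.
  have [d ed] : exists d : nat, dot (val b) x = d%:R.
    by apply/natrP; rewrite natrEint dot_root_int ?pos_root // (le_trans ler01).
  have led : (d <= (\sum_(i < l) c i) * q)%N.
    rewrite -(ler_nat R) -ed; apply: le_trans (dot_pos_root_le bP _) _ => [i|].
      exact: le_trans ler01 (x_ge1 i).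
    rewrite dot_theta natrM natr_sum mulr_suml ler_sum // => i _.
    by rewrite ler_wpM2l //; case/andP: (xq i).
  move: b_ge1; rewrite ed ler1n => d_gt0.
  (* For d > 0 this quotient plus one is the ceiling of d / q. *)
  have ltk : ((d.-1 %/ q).+1 < h)%N.
    by rewrite ltnS ltn_divLR // prednK.
  exists (Ordinal ltk); split=> // _ /=.
  have -> : ((d.-1 %/ q).+1%:Z - 1)%:~R = (d.-1 %/ q)%:R :> R.
    by rewrite -addn1 PoszD addrK.
  rewrite -!natrM natr1 !ler_nat.
  have := divn_eq d.-1 q; have := ltn_pmod d.-1 q_gt0.
  by move: (d.-1 %/ q)%N (d.-1 %% q)%N => a r; nia.
exists [ffun b => f b] => [b nb|b bP]; first by rewrite ffunE; apply: (fP b).1.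
rewrite -[b]/(val [` pos_root bP]%fset) address_valueE ffunE.
exact: (fP [` pos_root bP]%fset).2.
Qed.

Lemma address_inj f g : normalized f -> normalized g ->
  (forall b, pos b -> address_value f b = address_value g b) -> f = g.
Proof.
move=> nf ng fg; apply/ffunP => b; have [bP|nb] := pselect (pos (val b)).
  by apply/val_inj; have := fg _ bP; rewrite !address_valueE => -[].
by rewrite nf ?ng.
Qed.

(** * Counting the complement of the Linial arrangement modulo q *)

Definition off_linial (n q : nat) (x : V) : Prop :=
  forall a k, linial Phi alpha n (a, k) -> ~ eqmodR q (dot a x) k%:R.

(** The number (b, x) - (f b - 1) q represents (b, x) modulo q and lies between 1 and q; as n < q,
    it avoids 1, ..., n modulo q iff it exceeds n. *)
Lemma off_linial_class n q x f : (n < q)%N -> lattice x -> in_class q 0 x f ->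
  off_linial n q x <-> in_class q n x f.
Proof.
move=> ltnq xL xf; split=> [xoff b bP|xnf b k [bP /andP[k_ge1 len]] [z ez]].
  have /andP[xf1 xf2] := xf b bP; rewrite xf2 andbT.
  have /intrP[d ed] := dot_root_int xL (pos_root bP).
  have toZ (k : int) : k%:~R * q%:R = (k * q%:Z)%:~R :> R by rewrite rmorphM.
  rewrite leNgt; apply/negP => lt_n.
  move: xf1 lt_n; rewrite ed !toZ !pmulrn -!rmorphD /=.
  rewrite ler_int ltr_int => xf1 lt_n.
  have [k ek] : exists k : nat, d - (f b - 1) * q = k%:Z.
    by exists (absz (d - (f b - 1) * q)%R); lia.
  case: (xoff b k); first by split=> //=; lia.
  by exists (f b - 1); rewrite ed toZ pmulrn -rmorphB /= -ek; congr (_%:~R); ring.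
have /andP[xf1 xf2] := xnf b bP.
have kR : 1 <= k%:R :> R by rewrite ler1n.
have knR : k%:R <= n%:R :> R by rewrite ler_nat.
have : (f b - 1)%:~R * q%:R < z%:~R * q%:R :> R.
  by rewrite -ez; move: xf1; rewrite -natr1; lra.
have : z%:~R * q%:R < (f b)%:~R * q%:R :> R by rewrite -ez; lra.
by rewrite !ltr_pM2r ?ltr0n ?(leq_ltn_trans _ ltnq) // !ltr_int; lia.
Qed.

(** Coordinates run over 1, ..., q and not 0, ..., q - 1, to match cells that contain their upper
    walls. *)
Lemma box_points q : exists X : {ffun 'I_l -> 'I_q} -> V,
  forall z i, dot (alpha i) (X z) = (z i).+1%:R.
Proof.
have /choice[X XE] : forall z : {ffun 'I_l -> 'I_q}, exists x : V,
    forall i, dot (alpha i) x = (z i).+1%:R.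
  by move=> z; apply: simple_coordinates.
by exists X.
Qed.

Lemma lattice_coset_shift q x z : lattice z ->
  lattice_coset alpha q (x + z *+ q) = lattice_coset alpha q x.
Proof.
move=> zL; apply/seteqP; split=> _ [y yL <-] /=.
  exists (z + y); last by rewrite mulrnDl addrA.
  by move=> i; rewrite dotDr rpredD.
exists (y - z); last by rewrite mulrnBl -addrA [z *+ q + _]addrC subrK.
by move=> i; rewrite dotBr rpredB.
Qed.

Section BoxCount.
Variables (q : nat) (X : {ffun 'I_l -> 'I_q} -> V).
Hypothesis q_gt0 : (0 < q)%N.
Hypothesis XE : forall z i, dot (alpha i) (X z) = (z i).+1%:R.

Lemma box_lattice z : lattice (X z).
Proof. by move=> i; rewrite XE rpred_nat. Qed.

Lemma box_bound z i : 1 <= dot (alpha i) (X z) <= q%:R.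
Proof. by rewrite XE ler1n ler_nat ltn_ord. Qed.

Lemma card_complement n :
  set_card (complement_mod alpha (linial Phi alpha n) q) =
  #|[pred z | `[< off_linial n q (X z) >]]|.
Proof.
apply: (@set_card_param _ _ [pred z | _] (fun z => lattice_coset alpha q (X z))).
- move=> y z _ _ eyz; apply/ffunP => i; apply/val_inj => /=.
  have : lattice_coset alpha q (X y) (X y).
    by exists 0; rewrite ?mul0rn ?addr0 // => j; rewrite dotC dot0l rpred0.
  rewrite eyz => -[v vL /(congr1 (dot (alpha i)))].
  rewrite dotDr dotMnr !XE; have /intrP[k ->] := vL i.
  rewrite -[_ *+ q]mulr_natr !pmulrn -rmorphM -rmorphD /= => /intr_inj.
  have := ltn_ord (y i); have := ltn_ord (z i).
  move: (y i : nat) (z i : nat) => a b lta ltb e.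
  have [k0|[k0|k0]] : k <= -1 \/ k = 0 \/ 1 <= k by lia.
  - have : k * q%:Z <= - q%:Z by nia.
    lia.
  - by move: e; rewrite k0; lia.
  - have : q%:Z <= k * q%:Z by nia.
    lia.
- move=> z /asboolP zoff; exists (X z) => //; split=> //; exact: box_lattice.
move=> _ [x [xL xoff] <-].
have /choice[d dE] : forall i, exists d : int, dot (alpha i) x = d%:~R.
  by move=> i; apply/intrP; exact: (xL i).
have q0 : q%:Z != 0 by lia.
have ltz i : (`|((d i - 1) %% q)%Z| < q)%N.
  by rewrite -ltz_nat gez0_abs ?modz_ge0 // ltz_pmod.
(* Division is applied to d i - 1 because the box coordinate is z i + 1. *)
pose z := [ffun i => Ordinal (ltz i)].
have [v vE] := simple_coordinates (fun i => (((d i - 1) %/ q)%Z)%:~R).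
have vL : lattice v by move=> i; rewrite vE rpred_int.
have ex : x = X z + v *+ q.
  apply/eqP; rewrite -subr_eq0; apply/eqP; apply: simple_nondegenerate => i.
  rewrite dotBr dotDr dotMnr dE XE vE ffunE /= -natr1.
  rewrite pmulrn gez0_abs ?modz_ge0 //.
  have := divz_eq (d i - 1) q => /(congr1 (fun m : int => m%:~R : R)).
  by rewrite intrB intrD rmorphM /= -mulr_natr -[q%:R]/(q%:~R); lra.
exists z; last by rewrite ex lattice_coset_shift.
apply/asboolP => a k aP [m em]; apply: (xoff a k aP).
have [[aPos _] _] := aP; have /intrP[t et] := dot_root_int vL aPos.
exists (m + t); rewrite ex dotDr dotMnr et intrD mulrDl -em -mulr_natr; ring.
Qed.

(** The value 1 at the simple roots confines the class to the box. *)
Lemma card_box_class n f : (forall i, f (alpha i) = 1) ->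
  set_card [set x | lattice x /\ in_class q n x f]%classic =
  #|[pred z | `[< in_class q n (X z) f >]]|.
Proof.
move=> f1; apply: (@set_card_param _ _ [pred z | _] X).
- move=> y z _ _ eyz; apply/ffunP => i; apply/val_inj => /=.
  by have := XE y i; rewrite eyz XE => /eqP; rewrite eqr_nat eqSS => /eqP.
- by move=> z /asboolP zf; split=> //; exact: box_lattice.
move=> x [xL xf].
have /choice[d dE] : forall i, exists d : 'I_q, dot (alpha i) x = d.+1%:R.
  move=> i; have /andP[] := in_class_weaken xf (simple_pos i).
  rewrite f1 subrr mul0r add0r mul1r => x1 xq.
  have /natrP[[|d] ed] : dot (alpha i) x \is a Num.nat.
  - rewrite natrEint (le_trans ler01 x1) andbT; exact: (xL i).
  - by move: x1; rewrite ed ler10.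
  by rewrite ed ler_nat in xq; exists (Ordinal xq).
have ex : X [ffun i => d i] = x.
  apply/eqP; rewrite -subr_eq0; apply/eqP; apply: simple_nondegenerate => i.
  by rewrite dotBr XE ffunE dE subrr.
by exists [ffun i => d i]; rewrite //= ex; apply/asboolP.
Qed.

End BoxCount.

(** The points of the box are sorted by address; each cell contributes a shifted copy of [nsol] by
    [card_class], whose shift is n + 1 times a number independent of n and q. *)
Lemma worpitzky_partition (C : numClosedFieldType) : exists Rp : {poly C},
  (forall n q : nat, (n < q)%N ->
    (set_card (complement_mod alpha (linial Phi alpha n) q))%:R =
    shift_act (Rp \Po 'X^(n.+1)) (nsol C (mark c)) q) /\
  shift_act Rp (nsol C (mark c)) =1 pos_power C l.
Proof.
pose valid (f : address) := [/\ normalized f,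
  forall i, address_value f (alpha i) = 1 & exists L, adapted L (address_value f)].
have /choice[Lf LfP] : forall f : address, exists L, valid f -> adapted L (address_value f).
  move=> f; have [[_ _ [L LP]]|nv] := pselect (valid f); first by exists L.
  by exists simple_walls => /nv.
pose Rp : {poly C} := \sum_(f | `[< valid f >]) 'X^(asc (Lf f)).
have RpE n t : shift_act (Rp \Po 'X^(n.+1)) (nsol C (mark c)) t =
    \sum_(f | `[< valid f >]) nsol C (mark c) (t - (n.+1 * asc (Lf f))%:Z).
  rewrite /Rp rmorph_sum shift_act_sum; apply: eq_bigr => f _.
  by rewrite /= comp_Xn_poly -exprM shift_actXn.
have count n q : (n < q)%N ->
    (set_card (complement_mod alpha (linial Phi alpha n) q))%:R =
    shift_act (Rp \Po 'X^(n.+1)) (nsol C (mark c)) q.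
  move=> ltnq; have q_gt0 := leq_ltn_trans (leq0n n) ltnq.
  have [X XE] := box_points q; rewrite RpE (card_complement q_gt0 XE).
  have /choice[ad adP] : forall z, exists f, normalized f /\ in_class q 0 (X z) (address_value f).
    move=> z; have [f ? ?] := address_exists q_gt0 (box_lattice XE z) (box_bound XE z).
    by exists f.
  rewrite -sum1_card (partition_big ad xpredT) //= natr_sum [RHS]big_mkcond.
  apply: eq_bigr => f _; rewrite sum1_card; case: asboolP => [fV|nfV]; last first.
    rewrite (@eq_card0 _ [pred z | _]) // => z; rewrite !inE; apply/negP.
    move=> /andP[_ /eqP adz]; case: nfV; have [nf zf] := adP z; rewrite adz in nf zf.
    split=> // [i|]; last by apply: exists_adapted zf => //; exact: box_lattice XE z.
    (* A point of the box has 0 < (alpha_i, x) <= q, so its address is 1 at alpha_i. *)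
    have /andP[+ +] := zf _ (simple_pos i); have /andP[] := box_bound XE z i.
    move: (dot _ _) (address_value f _) => d k d1 dq dk1 dk2.
    have : (k - 1)%:~R * q%:R < q%:R :> R by lra.
    have : 0 < k%:~R * q%:R :> R by lra.
    rewrite pmulr_lgt0 ?ltr0n // ltr0z => k0; rewrite -[X in _ < X]mul1r ltr_pM2r ?ltr0n //.
    by rewrite -[1]/(1%:~R) ltr_int; lia.
  have [nf f1 _] := fV; rewrite -(card_class C q n (LfP f fV)) (card_box_class XE n f1).
  congr (_%:R); apply: eq_card => z; rewrite !inE.
  have [nfz zf] := adP z; have zL := box_lattice XE z.
  apply/andP/asboolP => [[/asboolP zoff /eqP <-]|zfn].
    exact/(off_linial_class ltnq zL zf).
  have zf0 := in_class_weaken zfn; split; last first.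
    by apply/eqP; apply: address_inj => // b bP; apply: in_class_uniq zf zf0 b bP.
  by apply/asboolP/(off_linial_class ltnq zL zf0).
exists Rp; split=> // t; rewrite -[Rp]comp_polyXr -['X]expr1 RpE /pos_power.
case: ltP => [t_gt0|t_le0]; last first.
  (* Every shift is at least 1, so for t <= 0 only negative arguments of [nsol] occur. *)
  rewrite big1 // => f /asboolP/LfP[LW _ _ _]; have := asc_gt0 LW.
  by case E: (t - _) => [k|//]; lia.
case: t t_gt0 => [q|//]; rewrite ltz_nat => q_gt0.
(* For n = 0 no hyperplane is removed, and all q^l points of the box are counted. *)
rewrite -RpE -count //; have [X XE] := box_points q.
rewrite (card_complement q_gt0 XE) -[_%:~R ^+ l]/(q%:R ^+ l) -natrX; congr (_%:R).
rewrite -[RHS](congr2 expn (card_ord q) (card_ord l)) -card_ffun.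
apply: eq_card => z; rewrite !inE; apply/asboolP => a k [_] /=; lia.
Qed.

(** * Ehrhart and characteristic quasi-polynomials *)

Lemma card_dilated_alcove (C : numFieldType) (q : nat) :
  (set_card (lattice `&` dilated_alcove alpha theta q)%classic)%:R = nsol C (mark c) q.
Proof.
have := card_wall_points C q (fun=> 0%N) wall_system_simple.
rewrite big1 => [|j _]; last by rewrite muln0.
rewrite subr0 => <-; congr (set_card _)%:R; apply/seteqP.
split=> x [xL].
  move=> [x_ge0 x_le]; split=> // j; case: (unliftP ord0 j) => [i|] ->.
    by rewrite simple_walls_lift /aff_eval mulr0 addr0; exact: x_ge0.
  by rewrite simple_walls0 /aff_eval dotNl mulr1 addrC subr_ge0.
move=> xw; split=> //; split=> [i|].
  by have := xw (lift ord0 i); rewrite simple_walls_lift /aff_eval mulr0 addr0.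
by have := xw ord0; rewrite simple_walls0 /aff_eval dotNl mulr1 addrC subr_ge0.
Qed.

Lemma is_ehrhart_ehrhart : is_ehrhart alpha theta (ehrhart alpha theta).
Proof.
apply: xgetPex; have [L Lqp LE] := nsol_quasi_polynomial R[i] mark_gt0.
by exists L; split=> // q q_gt0; rewrite LE ?card_dilated_alcove.
Qed.

(** At large q all shifted arguments are positive, where the Ehrhart quasi-polynomial equals [nsol],
    so the right side has the required values. *)
Lemma char_quasi_linial (Rp : {poly R[i]}) n :
  (forall q : nat, (n < q)%N ->
    (set_card (complement_mod alpha (linial Phi alpha n) q))%:R =
    shift_act (Rp \Po 'X^(n.+1)) (nsol R[i] (mark c)) q) ->
  char_quasi alpha (linial Phi alpha n) =1
  shift_act (Rp \Po 'X^(n.+1)) (ehrhart alpha theta).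
Proof.
move=> count; have [Lqp LE] := is_ehrhart_ehrhart.
have LE1 (t : int) : 1 <= t -> ehrhart alpha theta t = nsol R[i] (mark c) t.
  by case: t => // q q_gt0; rewrite LE ?card_dilated_alcove.
have chiP : is_char_quasi alpha (linial Phi alpha n)
    (shift_act (Rp \Po 'X^(n.+1)) (ehrhart alpha theta)).
  split; first exact: quasi_polynomial_shift_act.
  exists (maxn n (size (Rp \Po 'X^(n.+1)))) => q; rewrite gtn_max => /andP[ltnq ltq].
  by rewrite count // (shift_act_far LE1) // lez_nat ltnW.
(* [char_quasi] is some function meeting the specification; it is identified by its values at large
   q. *)
have [qp [N1 eN1]] := xgetI (fun=> 0) chiP; have [qp' [N2 eN2]] := chiP.
apply: (@quasi_polynomial_eq _ _ _ (maxn N1 N2)) => // q; rewrite gtn_max => /andP[lt1 lt2].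
exact: etrans (eN1 _ lt1) (esym (eN2 _ lt2)).
Qed.

End WallSystems.

Unset Implicit Arguments.

Theorem theorem3p4 (R : realType) (l : nat) (Phi : {fset 'rV[R]_l})
    (alpha : 'I_l -> 'rV[R]_l) (c : 'I_l -> nat) (rho n : nat)
    (theta := \sum_(i < l) alpha i *+ c i)
    (g := gcdn n.+1 rho) (mu := (n.+1 %/ g)%N) :
  irreducible_root_system Phi ->
  simple_roots Phi alpha ->
  highest_root Phi alpha theta ->
  is_minimal_period (ehrhart alpha theta) rho ->
  forall t : int,
    char_quasi alpha (linial Phi alpha n) t =
    shift_act
      (\prod_(j < l.+1) ((mu%:R)^-1 *: qint mu ('X^(mark c j * g) : {poly R[i]})))
      (char_quasi alpha (linial Phi alpha g.-1)) t.
Proof.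
move=> [rootsP _ _] simpleP highestP [rho_period _] t.
have [Rp [count RpN]] := worpitzky_partition rootsP simpleP highestP R[i].
have marks_gt0 := mark_gt0 simpleP highestP.
have [Lqp LE] := is_ehrhart_ehrhart rootsP simpleP highestP.
have LE1 (s : int) : 1 <= s -> ehrhart alpha theta s = nsol R[i] (mark c) s.
  by case: s => // q q_gt0; rewrite LE ?(card_dilated_alcove rootsP simpleP highestP).
have g_gt0 : (0 < g)%N by rewrite gcdn_gt0.
have chi m := char_quasi_linial rootsP simpleP highestP (count m).
(* The arrangement with parameter g - 1 corresponds to P(S^g), since (g - 1) + 1 = g. *)
have chi_g := chi g.-1; rewrite prednK // in chi_g.
rewrite chi (eq_shift_act _ chi_g).
have DL := mark_prod_quasi marks_gt0 Lqp LE1.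
have marks_rho := mark_dvd_period marks_gt0 rho_period LE1.
exact: (dilation_shift marks_gt0 (card_ord l.+1) n RpN DL marks_rho t).
Qed.
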